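(* Let $X$ be a non-degenerate $d$-variate random vector with $M_X(t)=\mathbb{E}[\exp(t^\top X)]<\infty$ for each $t\in\mathbb{R}^d$, and let $\varphi_X(t)=\mathbb{E}[\exp(\mathrm{i}t^\top X)]$, $t\in\mathbb{R}^d$. Let $\mu\in\mathbb{R}^d$. Then the identity $$\varphi_X(t)\,M_X(t)-e^{(\mathrm{i}+1)t^\top\mu}=0\quad\text{for each }t\in\mathbb{R}^d$$ holds if, and only if, $X$ follows some normal distribution with mean $\mu$.
   Context: $\varphi_X$ is the characteristic function and $M_X$ the moment generating function of $X$; $\mathrm{i}$ is the imaginary unit. Vectors are column vectors and $^\top$ denotes transposition. *)

(* Defs.v *)
From HB Require Import structures.
From mathcomp Require Import all_boot all_order all_algebra.
From mathcomp Require Import all_classical all_reals all_analysis.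
From mathcomp Require Import complex.
Set Implicit Arguments.
Unset Strict Implicit.
Unset Printing Implicit Defensive.
Import Order.TTheory GRing.Theory Num.Theory.
Import numFieldNormedType.Exports.
Local Open Scope classical_set_scope.
Local Open Scope ring_scope.
Local Open Scope complex_scope.

Definition dotv (R : realType) (n : nat) (t x : 'cV[R]_n) : R :=
  (t^T *m x) ord0 ord0.

Definition cexp (R : realType) (z : R[i]) : R[i] :=
  (expR (complex.Re z))%:C * (cos (complex.Im z) +i* sin (complex.Im z)).

Section RandomVector.
Context (disp : measure_display) (T : measurableType disp) (R : realType).
Variables (P : probability T R) (n : nat).

(* Entrywise measurability is measurability for the Borel sigma-algebra of
   R^n, since the latter is the product sigma-algebra. *)
Definition random_vector (X : T -> 'cV[R]_n) : Prop :=
  forall i : 'I_n, measurable_fun [set: T] (fun w => X w i ord0).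

(* Not almost surely constant.  This is weaker than "not concentrated on an
   affine hyperplane"; singular, non-constant laws are allowed. *)
Definition nondegenerate_vector (X : T -> 'cV[R]_n) : Prop :=
  ~ exists c : 'cV[R]_n, {ae P, forall w, X w = c}.

(* Meaningful only when the real and imaginary parts of Z are integrable. *)
Definition cexpectation (Z : T -> R[i]) : R[i] :=
  fine ('E_P[fun w => complex.Re (Z w)])%E +i* fine ('E_P[fun w => complex.Im (Z w)])%E.

Definition mgf (X : T -> 'cV[R]_n) (t : 'cV[R]_n) : \bar R :=
  ('E_P[fun w => expR (dotv t (X w))])%E.

Definition characteristic_function (X : T -> 'cV[R]_n) (t : 'cV[R]_n) : R[i] :=
  cexpectation (fun w => cexp ('i * (dotv t (X w))%:C)).

(* Univariate normal law N(m, s ^+ 2).  For s = 0 it is the point mass at m,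
   whereas normal_prob m 0 is the uniform law on [0, 1]. *)
Definition normal_law (m s : R) (B : set R) : \bar R :=
  if s == 0 then \d_m B else normal_prob m s B.

Definition normal_variable (Y : T -> R) : Prop :=
  exists m s : R, 0 <= s /\
    forall B : set R, measurable B -> P (Y @^-1` B) = normal_law m s B.

(* Multivariate normality, possibly with a singular covariance matrix:
   every linear combination of the components is univariate normal. *)
Definition normal_vector (X : T -> 'cV[R]_n) : Prop :=
  forall t : 'cV[R]_n, normal_variable (fun w => dotv t (X w)).

Definition has_mean (X : T -> 'cV[R]_n) (mu : 'cV[R]_n) : Prop :=
  forall i : 'I_n, ('E_P[fun w => X w i ord0])%E = (mu i ord0)%:E.

End RandomVector.

(* Main.v *)
Require Import Defs.
From HB Require Import structures.
From mathcomp Require Import all_boot all_order all_algebra.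
From mathcomp Require Import all_classical all_reals all_analysis.
From mathcomp Require Import complex.
From mathcomp Require Import measurable_realfun.
From mathcomp Require Import ring lra zify.
Import Order.TTheory GRing.Theory Num.Theory.
Import numFieldNormedType.Exports.
Local Open Scope classical_set_scope.
Local Open Scope ring_scope.

(* Projecting reduces the converse to a centred real variable Y whose Laplace
   transform F(z) = E exp(zY) satisfies F(x) F(ix) = 1 for real x.  Then F is
   even and F'(z) F(iz) is its logarithmic derivative, so F = exp g with g
   entire and g(iz) = - g(z); only the coefficients g_n with n = 2 mod 4
   survive.  Since |F(z)| <= F(Re z), the function h = Re g satisfies
   h(r e^(i theta)) <= g(r cos theta), hence h(r e^(i theta)) >= - g(r sin theta).
   On the arc |theta| <= pi/4, h is an odd sine series in
   psi = pi/2 - 2 theta, bounded below by - g(sqrt t) where r = sqrt (2t);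
   integrating against the nonnegative weights m sin psi +- sin(m psi) gives,
   for m = 2k+1 >= 3,
     |g_(2m)| (2t)^m <= 2 m g_2 t + (4/3) (m + 1/3) g(sqrt t).
   Summing these with weights 2^-m bounds g(sqrt t) by a multiple of t plus
   (8/9) g(sqrt t), so g(sqrt t) = O(t) and g is quadratic.

   A law is determined by its characteristic function: equality of expectations
   extends to trigonometric polynomials, then by (1 - v^n)^(m_n) with
   v = sin^2((x - a) / j) to indicators of periodic unions of intervals, and to
   intervals as the period tends to infinity. *)

(** * Entire power series *)

Section EntireSeries.
Variable R : realType.
Implicit Types (a b : nat -> R) (r x K : R).

(** Equivalent to infinite radius of convergence. Boundedness at every radius passes easily to
    products and derivatives, and boundedness at [2 * r] already gives geometric decay at [r]. *)
Definition entire a := forall r, exists K, forall n, `|a n * r ^+ n| <= K.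

Definition psum a x : R := limn (pseries a x).

(** The coefficients of the Cauchy product. *)
Definition conv a b (n : nat) : R := \sum_(i < n.+1) a i * b (n - i)%N.

Lemma entire_half a r : entire a ->
  exists2 K, 0 <= K & forall n, `|a n * r ^+ n| <= K * 2^-1 ^+ n.
Proof.
move=> /(_ (2 * r))[K hK]; exists K.
  exact: le_trans (normr_ge0 _) (hK 0%N).
move=> n; have := hK n.
rewrite exprMn mulrCA normrM (ger0_norm (exprn_ge0 _ _))// exprVn.
by rewrite ler_pdivlMr ?exprn_gt0// mulrC.
Qed.

Lemma sub_entire a b : entire b -> (forall n, `|a n| <= `|b n|) -> entire a.
Proof.
move=> eb ab r; have [K hK] := eb r; exists K => n.
by rewrite (le_trans _ (hK n))// !normrM ler_wpM2r.
Qed.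

Lemma entire_mul_bounded a b : entire a -> (forall n, `|b n| <= 1) ->
  entire (fun n => a n * b n).
Proof.
by move=> ea b1; apply: (sub_entire _ _ ea) => n; rewrite normrM ler_piMr.
Qed.

Lemma normed_cvg_pseries a x : entire a -> cvgn [normed pseries a x].
Proof.
move=> ea; have [K K0 hK] := entire_half a x ea.
apply: (@series_le_cvg _ _ (geometric K 2^-1)) => [n|n|n|].
- exact: normr_ge0.
- by rewrite geometric_ge0.
- exact: hK.
- by apply: is_cvg_geometric_series; rewrite ger0_norm ?invf_lt1 ?ltr1n.
Qed.

Lemma is_cvg_pseries a x : entire a -> cvgn (pseries a x).
Proof. by move=> ea; apply: normed_cvg; exact: normed_cvg_pseries. Qed.

Lemma entire_diffs a : entire a -> entire (pseries_diffs a).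
Proof.
move=> ea r; have [K K0 hK] := entire_half a (`|r| + 1) ea; exists K => n.
have r1 : 1 <= `|r| + 1 by rewrite lerDr.
have := hK n.+1; rewrite /pseries_diffs.
rewrite !normrM !normrX (ger0_norm (le_trans ler01 r1)) exprVn => h.
(* The factor [n.+1] produced by differentiation is absorbed by the geometric decay at the larger
   radius. *)
have n2 : n.+1%:R <= 2 ^+ n.+1 :> R.
  by rewrite -natrX ler_nat ltnW// ltn_expl.
rewrite normr_nat.
apply: (@le_trans _ _ (2 ^+ n.+1 * (`|a n.+1| * (`|r| + 1) ^+ n.+1))).
  rewrite -mulrA ler_pM ?mulr_ge0 ?exprn_ge0// ler_wpM2l//.
  rewrite (@le_trans _ _ ((`|r| + 1) ^+ n))//.
    by rewrite lerXn2r ?nnegrE ?addr_ge0// lerDl.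
  by rewrite ler_weXn2l.
by rewrite mulrC -ler_pdivlMr ?exprn_gt0.
Qed.

Lemma is_derive_psum a x : entire a ->
  is_derive x 1 (psum a) (psum (pseries_diffs a) x).
Proof.
move=> ea; have e1 := entire_diffs _ ea; have e2 := entire_diffs _ e1.
apply: (@pseries_snd_diffs _ _ (`|x| + 1)); try exact: is_cvg_pseries.
by rewrite [ltRHS]ger0_norm ?addr_ge0// ltrDl.
Qed.

Lemma psum0 a : psum a 0 = a 0%N.
Proof.
apply/cvg_lim => //; rewrite -cvg_shiftS/=.
rewrite [X in X @ _ --> _](_ : _ = cst (a 0%N)); first exact: cvg_cst.
apply/funext => n; rewrite /pseries/series/= big_nat_recl//= expr0 mulr1.
by rewrite big1 ?addr0// => i _; rewrite exprS mul0r mulr0.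
Qed.

(** Values at 0 give the constant coefficients; the derivatives agree as well, so induction on the
    index reaches every coefficient. *)
Lemma psum_inj a b : entire a -> entire b -> psum a =1 psum b -> a =1 b.
Proof.
move=> + + + n; elim: n a b => [|n IH] a b ea eb ab.
  by rewrite -!psum0 ab.
have/IH : psum (pseries_diffs a) =1 psum (pseries_diffs b).
  move=> x.
  have [_ <-] := is_derive_psum a x ea; have [_ <-] := is_derive_psum b x eb.
  by rewrite (_ : psum a = psum b)//; apply/funext.
move=> /(_ (entire_diffs _ ea) (entire_diffs _ eb)).
by rewrite /pseries_diffs => /mulfI; apply; rewrite pnatr_eq0.
Qed.

Lemma psum_tail a x K N : 0 <= K -> entire a ->
  (forall n, `|a n * x ^+ n| <= K * 2^-1 ^+ n) ->
  `|psum a x - \sum_(0 <= n < N) a n * x ^+ n| <= 2 * K * 2^-1 ^+ N.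
Proof.
move=> K0 ea hK.
have h M : (N <= M)%N ->
    `|pseries a x M - pseries a x N| <= 2 * K * 2^-1 ^+ N.
  move=> NM; rewrite sub_series_geq//.
  rewrite (le_trans (ler_norm_sum _ _ _))//.
  apply: (@le_trans _ _ (\sum_(N <= i < M) K * 2^-1 ^+ i)).
    by apply: ler_sum => i _; exact: hK.
  rewrite -mulr_sumr -(subnKC NM) geometric_partial_tail [2 * K]mulrC -mulrA.
  rewrite ler_wpM2l//.
  have := @geometric_le_lim R (M - N) (2^-1 ^+ N) 2^-1.
  rewrite exprn_ge0// invr_gt0 ltr0n ger0_norm// invf_lt1// ltr1n.
  move=> /(_ isT isT isT)/le_trans; apply.
  by rewrite (_ : 1 - 2^-1 = 2^-1) ?invrK 1?mulrC//; lra.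
have cv : `|pseries a x n - pseries a x N| @[n --> \oo] -->
    `|psum a x - pseries a x N|.
  by apply: cvg_norm; apply: cvgB; [exact: is_cvg_pseries|exact: cvg_cst].
rewrite -(cvg_lim (@Rhausdorff R) cv); apply: limr_le; first by apply: cvgP cv.
by near=> n; apply: h; near: n; exact: nbhs_infty_ge.
Unshelve. all: end_near. Qed.

End EntireSeries.

Arguments entire {R} a.
Arguments psum {R} a x.
Arguments conv {R} a b n.

Section Products.
Variable R : realType.
Implicit Types (a b : nat -> R) (r x K : R).

Lemma entire_conv a b : entire a -> entire b -> entire (conv a b).
Proof.
move=> ea eb r.
have [K K0 hK] := entire_half _ a r ea; have [L L0 hL] := entire_half _ b r eb.
exists (K * L) => n.
have n2 : n.+1%:R * 2^-1 ^+ n <= 1 :> R.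
  by rewrite exprVn ler_pdivrMr ?exprn_gt0// mul1r -natrX ler_nat ltn_expl.
rewrite (@le_trans _ _ (n.+1%:R * (K * L * 2^-1 ^+ n)))//; last first.
  by rewrite mulrCA ler_piMr// mulr_ge0.
rewrite /conv mulr_suml (le_trans (ler_norm_sum _ _ _))//.
rewrite mulr_natl -[X in _ *+ X]card_ord -sumr_const ler_sum// => i _.
have ni : (i <= n)%N by rewrite -ltnS.
rewrite -[in r ^+ n](subnKC ni) -[in 2^-1 ^+ n](subnKC ni) !exprD.
rewrite mulrACA normrM [leRHS]mulrACA ler_pM//.
Qed.

Let series_conv (u v : nat -> R) N :
  series (conv u v) N = \sum_(i < N) u i * series v (N - i)%N.
Proof.
elim: N => [|N IH]; first by rewrite /series/= big_nil big_ord0.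
rewrite seriesSr/= IH big_ord_recr/= subSnn.
rewrite [in RHS](_ : series v 1 = v 0%N); last first.
  by rewrite /series/= big_nat1.
rewrite {1}/conv big_ord_recr/= subnn addrA; congr (_ + _).
rewrite -big_split/=; apply: eq_bigr => i _.
by rewrite subSn ?(ltnW (ltn_ord i))// seriesSr mulrDr.
Qed.

(** With V the partial sums of [v], the product of the N-th partial sums minus the N-th partial sum
    of the Cauchy product is the sum over i < N of u_i (V_N - V_(N-i)). Each term is at most 4KL
    2^-N, so the difference is O(N 2^-N). *)
Lemma psumM a b x : entire a -> entire b ->
  psum a x * psum b x = psum (conv a b) x.
Proof.
move=> ea eb.
have [K K0 hK] := entire_half _ a x ea; have [L L0 hL] := entire_half _ b x eb.
pose u n := a n * x ^+ n; pose v n := b n * x ^+ n.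
have cu : series u @ \oo --> psum a x by exact: is_cvg_pseries.
have cv : series v @ \oo --> psum b x by exact: is_cvg_pseries.
have cuv : pseries (conv a b) x = series (conv u v).
  apply/funext => N; rewrite /pseries/series/=; apply: eq_bigr => n _.
  rewrite /conv mulr_suml; apply: eq_bigr => i _.
  have ni : (i <= n)%N by rewrite -ltnS.
  by rewrite -[in x ^+ n](subnKC ni) exprD mulrACA.
have uvd n m : (m <= n)%N -> `|series v n - series v m| <= 4 * L * 2^-1 ^+ m.
  move=> mn; have t k := psum_tail _ _ _ _ k L0 eb hL.
  rewrite -(subrKA (psum b x)) (le_trans (ler_normD _ _))//.
  rewrite [leRHS](_ : _ = 2 * L * 2^-1 ^+ m + 2 * L * 2^-1 ^+ m); last by ring.
  rewrite lerD ?t// distrC (le_trans (t n))// ler_wpM2l ?mulr_ge0//.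
  by rewrite ler_wiXn2l// invf_le1// ler1n.
have d0 : series u N * series v N - series (conv u v) N @[N --> \oo] --> 0.
  apply: norm_cvg0; apply: (@squeeze_cvgr _ _ _ _ (cst 0)
    (geometric (8 * K * L) (3 / 4))); last 2 first.
  - exact: cvg_cst.
  - by apply: cvg_geometric; rewrite ger0_norm; lra.
  apply: nearW => N; rewrite normr_ge0/= series_conv.
  rewrite {1}/series/= big_mkord mulr_suml -sumrB.
  rewrite (le_trans (ler_norm_sum _ _ _))//.
  apply: (@le_trans _ _ (\sum_(i < N) 4 * K * L * 2^-1 ^+ N)).
    apply: ler_sum => i _; rewrite -mulrBr normrM.
    rewrite (le_trans (ler_pM _ _ (hK i) (uvd N (N - i)%N (leq_subr _ _))))//.
    rewrite -[in 2^-1 ^+ N](subnKC (ltnW (ltn_ord i))) exprD.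
    by rewrite le_eqVlt; apply/orP; left; apply/eqP; ring.
  rewrite sumr_const card_ord -[_ *+ N]mulr_natr.
  have N2 : N%:R <= 2 * (3 / 2) ^+ N :> R.
    elim: N => [|k IH]; first by rewrite expr0; lra.
    have p1 : 1 <= (3 / 2) ^+ k :> R by rewrite exprn_ege1//; lra.
    rewrite exprS -[k.+1%:R]natr1; move: ((3 / 2) ^+ k) p1 IH => p p1 IH.
    lra.
  rewrite /geometric/= (_ : 3 / 4 = 3 / 2 * 2^-1); last by field.
  rewrite [(_ * 2^-1) ^+ _]exprMn.
  rewrite (_ : 8 * _ * _ * _ = 4 * K * L * 2^-1 ^+ N * (2 * (3 / 2) ^+ N)).
    by rewrite ler_wpM2l// !mulr_ge0 ?exprn_ge0.
  by ring.
apply/esym/cvg_lim => //; rewrite cuv.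
rewrite (_ : series _ = (fun N => series u N * series v N -
    (series u N * series v N - series (conv u v) N))); last first.
  by apply/funext => N; rewrite subKr.
by rewrite -[_ * _]subr0; apply: cvgB => //; exact: cvgM.
Qed.

Lemma psum_monomial a k x : (forall n, n != k -> a n = 0) -> psum a x = a k * x ^+ k.
Proof.
move=> a0; apply/cvg_lim => //; rewrite -(cvg_shiftn k.+1)/=.
rewrite [X in X @ _ --> _](_ : _ = cst (a k * x ^+ k)); first exact: cvg_cst.
apply/funext => n; rewrite /pseries/series/= big_mkord.
have kn : (k < n + k.+1)%N by rewrite addnS ltnS leq_addl.
rewrite (bigD1 (Ordinal kn))//= big1 ?addr0// => i ik.
by rewrite a0 ?mul0r.
Qed.

Lemma psum_cst0 x : psum (fun=> 0) x = 0.
Proof.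
apply/cvg_lim => //; rewrite [X in X @ _ --> _](_ : _ = cst 0); first exact: cvg_cst.
by apply/funext => n; rewrite /pseries/series/= big1// => i _; rewrite mul0r.
Qed.

End Products.

(** * Exponentials of power series along complex rays *)

Section PolarExp.
Variable R : realType.
Implicit Types (a b : nat -> R) (r x K : R).

(** Together with [sin_part], the real and imaginary parts of the sum of a_n z^n at z = r e^(ix), as
    power series in r. Complex values are thus reached through real series only. *)
Definition cos_part a x n : R := a n * cos (n%:R * x).
Definition sin_part a x n : R := a n * sin (n%:R * x).

Lemma entire_cos_part a x : entire a -> entire (cos_part a x).
Proof. by move=> ea; apply: entire_mul_bounded => // n; exact: cos_max. Qed.

Lemma entire_sin_part a x : entire a -> entire (sin_part a x).
Proof. by move=> ea; apply: entire_mul_bounded => // n; exact: sin_max. Qed.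

Lemma entireD a b : entire a -> entire b -> entire (fun n => a n + b n).
Proof.
move=> ea eb r; have [K hK] := ea r; have [L hL] := eb r.
exists (K + L) => n; rewrite mulrDl (le_trans (ler_normD _ _))//.
exact: lerD.
Qed.

Lemma psumD a b x : entire a -> entire b ->
  psum (fun n => a n + b n) x = psum a x + psum b x.
Proof.
move=> ea eb; rewrite /psum -lim_seriesD; try exact: is_cvg_pseries.
by congr (limn (series _)); apply/funext => n /=; rewrite mulrDl.
Qed.

Lemma psumB a b x : entire a -> entire b ->
  psum (fun n => a n - b n) x = psum a x - psum b x.
Proof.
move=> ea eb; rewrite /psum -lim_seriesB; try exact: is_cvg_pseries.
by congr (limn (series _)); apply/funext => n /=; rewrite mulrBl.
Qed.

Variables (a g : nat -> R) (x : R).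
Hypotheses (ea : entire a) (eg : entire g) (a0 : a 0%N = 1) (g0 : g 0%N = 0).
Hypothesis ag : pseries_diffs a =1 conv (pseries_diffs g) a.

Let U := psum (cos_part a x).
Let V := psum (sin_part a x).
Let h := psum (cos_part g x).
Let k := psum (sin_part g x).
Let h' := psum (pseries_diffs (cos_part g x)).
Let k' := psum (pseries_diffs (sin_part g x)).

Let eac := entire_cos_part _ x ea.
Let eas := entire_sin_part _ x ea.
Let egc := entire_diffs _ _ (entire_cos_part _ x eg).
Let egs := entire_diffs _ _ (entire_sin_part _ x eg).

Let angle n (i : 'I_n.+1) :
  n.+1%:R * x = i.+1%:R * x + (n - i)%N%:R * x.
Proof. by rewrite -mulrDl -natrD addSn subnKC// -ltnS. Qed.

(** With [dV], this is the equation A' = G' A along the ray: (U + iV)' = (h' + ik')(U + iV). In the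
    Cauchy product the angle (n+1)x splits as (i+1)x + (n-i)x. *)
Let dU r : is_derive r 1 U (h' r * U r - k' r * V r).
Proof.
apply: is_derive_eq; first exact: is_derive_psum.
rewrite !psumM// -psumB; try exact: entire_conv.
congr (psum _ r); apply/funext => n.
rewrite /pseries_diffs/cos_part mulrA -[_ * a _]/(pseries_diffs a n) ag.
rewrite /conv -sumrB mulr_suml; apply: eq_bigr => i _.
by rewrite /sin_part (angle _ i) cosD /pseries_diffs; ring.
Qed.

Let dV r : is_derive r 1 V (h' r * V r + k' r * U r).
Proof.
apply: is_derive_eq; first exact: is_derive_psum.
rewrite !psumM// -psumD; try exact: entire_conv.
congr (psum _ r); apply/funext => n.
rewrite /pseries_diffs/sin_part mulrA -[_ * a _]/(pseries_diffs a n) ag.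
rewrite /conv -big_split mulr_suml; apply: eq_bigr => i _.
by rewrite /cos_part (angle _ i) sinD /pseries_diffs /=; ring.
Qed.

Let dh r : is_derive r 1 h (h' r).
Proof. exact/is_derive_psum/entire_cos_part. Qed.

Let dk r : is_derive r 1 k (k' r).
Proof. exact/is_derive_psum/entire_sin_part. Qed.

Let dE r : is_derive r 1 (fun r => expR (- h r)) (- h' r * expR (- h r)).
Proof.
rewrite mulrC; apply: (@is_derive1_comp _ expR (fun r => - h r)).
exact: is_deriveN.
Qed.

Let dC r : is_derive r 1 (fun r => cos (k r)) (- sin (k r) * k' r).
Proof. exact: (@is_derive1_comp _ cos k). Qed.

Let dS r : is_derive r 1 (fun r => sin (k r)) (cos (k r) * k' r).
Proof. exact: (@is_derive1_comp _ sin k). Qed.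

Let psumc0 : [/\ U 0 = 1, V 0 = 0, h 0 = 0 & k 0 = 0].
Proof.
by rewrite /U /V /h /k !psum0 /cos_part /sin_part a0 g0 !mul0r cos0 sin0 mulr1 mulr0.
Qed.

(** P + iQ is (U + iV) exp(-(h + ik)). Its derivative vanishes and its value at 0 is 1, which gives
    A = exp G on the ray. *)
Let P r := (U r * cos (k r) + V r * sin (k r)) * expR (- h r).
Let Q r := (V r * cos (k r) - U r * sin (k r)) * expR (- h r).

Let P1 r : P r = 1.
Proof.
have [U0 V0 h0 k0] := psumc0.
have -> : 1 = P 0 by rewrite /P U0 V0 h0 k0 cos0 oppr0 expR0; ring.
apply: is_derive_0_is_cst => s.
have D := is_deriveM
  (is_deriveD (is_deriveM (dU s) (dC s)) (is_deriveM (dV s) (dS s))) (dE s).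
apply: (is_derive_eq D); rewrite /GRing.scale/= !fctE; ring.
Qed.

Let Q0 r : Q r = 0.
Proof.
have [U0 V0 h0 k0] := psumc0.
have -> : 0 = Q 0 by rewrite /Q U0 V0 h0 k0 sin0; ring.
apply: is_derive_0_is_cst => s.
have D := is_deriveM
  (is_deriveB (is_deriveM (dV s) (dC s)) (is_deriveM (dU s) (dS s))) (dE s).
apply: (is_derive_eq D); rewrite /GRing.scale/= !fctE; ring.
Qed.

Lemma psum_cos_part_exp r : U r = expR (h r) * cos (k r).
Proof.
rewrite -[LHS](mulr1) -(cos2Dsin2 (k r)) -[U r](mulr1) -(expRxMexpNx_1 (h r)).
transitivity (expR (h r) * (P r * cos (k r) - Q r * sin (k r))).
  by rewrite /P /Q; ring.
by rewrite P1 Q0; ring.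
Qed.

Lemma psum_sin_part_exp r : V r = expR (h r) * sin (k r).
Proof.
rewrite -[LHS](mulr1) -(cos2Dsin2 (k r)) -[V r](mulr1) -(expRxMexpNx_1 (h r)).
transitivity (expR (h r) * (P r * sin (k r) + Q r * cos (k r))).
  by rewrite /P /Q; ring.
by rewrite P1 Q0; ring.
Qed.

End PolarExp.

Arguments cos_part {R} a x n.
Arguments sin_part {R} a x n.

(** * Odd sine series bounded below on a half-period *)

Section SineSeries.
Variable R : realType.
Implicit Types (f g : R -> R) (x u v c G : R).

Lemma is_derive_ge0_le f df u v : u <= v ->
  (forall x, is_derive x 1 f (df x)) -> (forall x, u <= x <= v -> 0 <= df x) ->
  f u <= f v.
Proof.
move=> uv dF df0.
have cf : {within `[u, v], continuous f}.
  apply: continuous_subspaceT => y.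
  by apply: differentiable_continuous; apply/derivable1_diffP; case: (dF y).
apply: (ger0_derive1_le _ _ cf) => //; rewrite ?in_itv/= ?lexx ?uv//.
move=> x; rewrite in_itv/= => /andP[ux xv].
by rewrite derive1E derive_val df0// !ltW.
Qed.

(** By the triple-angle formula s = sin(pi/6) satisfies (s + 1)(2s - 1)^2 = 0, so s = 1/2; then sin
    x <= x gives 1/2 <= pi/6. *)
Lemma pi_ge3 : 3 <= pi :> R.
Proof.
pose s : R := sin (pi / 6).
have pi0 := pi_gt0 R.
have s0 : 0 < s by apply: sin_gt0_pi; lra.
have s3 : 3 * s - 4 * s ^+ 3 = 1.
  rewrite [RHS](_ : _ = sin (pi / 6 + (pi / 6 + pi / 6))); last first.
    by rewrite -[LHS](@sin_pihalf R); congr sin; field.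
  rewrite sinD [sin (_ + _)]sinD [cos (_ + _)]cosD -/s.
  have c2 : cos (pi / 6) * cos (pi / 6) = 1 - s ^+ 2 :> R.
    by rewrite -[LHS]expr2 cos2sin2.
  transitivity (s * (cos (pi / 6) * cos (pi / 6)) * 3 - s ^+ 3); last by ring.
  by rewrite c2; ring.
have : (s + 1) * (2 * s - 1) ^+ 2 = 0.
  by transitivity (1 - (3 * s - 4 * s ^+ 3)); [ring|rewrite s3 subrr].
move/eqP; rewrite mulf_eq0 gt_eqF ?addr_gt0//= sqrf_eq0 subr_eq0 => /eqP s2.
suff : s <= pi / 6 by lra.
have sx x : 0 <= x -> sin x <= x.
  move=> x0.
  have D (y : R) : is_derive y 1 (fun y : R => y - sin y) (1 - cos y) by exact: is_deriveB.
  have := is_derive_ge0_le _ _ 0 x x0 D; rewrite sin0 subr0 subr_ge0; apply.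
  by move=> y _; rewrite subr_ge0 cos_le1.
by apply: sx; lra.
Qed.

(** Induction with the addition formula. On [0, pi] it makes the weights m sin x + sin(mx) and m sin
    x - sin(mx) nonnegative. *)
Lemma norm_sin_natM n x : `|sin (n%:R * x)| <= n%:R * `|sin x|.
Proof.
elim: n => [|n IH]; first by rewrite !mul0r sin0 normr0.
rewrite -natr1 !mulrDl !mul1r sinD (le_trans (ler_normD _ _))// !normrM lerD//.
  by rewrite (le_trans _ IH)// ler_piMr// cos_max.
by rewrite ler_piMl// cos_max.
Qed.

(* Primitives exist explicitly for the functions below, so no integration
   theory is needed. *)
Definition int0pi f v :=
  exists2 F : R -> R, forall x, is_derive x 1 F (f x) & F pi - F 0 = v.

Lemma int0piD f g u v :
  int0pi f u -> int0pi g v -> int0pi (fun x => f x + g x) (u + v).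
Proof.
move=> [F dF <-] [H dH <-]; exists (F + H) => [x|]; first exact: is_deriveD.
by rewrite !fctE; ring.
Qed.

Lemma int0piZ f c v : int0pi f v -> int0pi (fun x => c * f x) (c * v).
Proof.
move=> [F dF <-]; exists (c *: F) => [x|]; first exact: is_deriveZ.
by rewrite !fctE /GRing.scale/=; ring.
Qed.

Lemma int0pi_eq f g u v : f =1 g -> u = v -> int0pi f u -> int0pi g v.
Proof. by move=> /funext <- <-. Qed.

Lemma int0pi_sum n (f : nat -> R -> R) (v : nat -> R) :
  (forall i, int0pi (f i) (v i)) ->
  int0pi (fun x => \sum_(i < n) f i x) (\sum_(i < n) v i).
Proof.
move=> h; elim: n => [|n IH].
  exists (cst 0); last by rewrite big_ord0 subrr.
  by move=> x; rewrite big_ord0; exact: is_derive_cst.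
by apply: int0pi_eq _ _ (int0piD _ _ _ _ IH (h n)) => [x|]; rewrite big_ord_recr.
Qed.

Lemma int0pi_ge0 f v : int0pi f v -> (forall x, 0 <= x <= pi -> 0 <= f x) ->
  0 <= v.
Proof.
move=> [F dF <-] f0; rewrite subr_ge0.
exact: is_derive_ge0_le (pi_ge0 R) dF f0.
Qed.

Let dcos c x : is_derive x 1 (fun x => cos (c * x)) (- sin (c * x) * c).
Proof.
apply: (@is_derive1_comp _ cos (fun x => c * x)).
by apply: (is_derive_eq (is_deriveZ _ _)); rewrite /GRing.scale/= mulr1.
Qed.

Let dsin c x : is_derive x 1 (fun x => sin (c * x)) (cos (c * x) * c).
Proof.
apply: (@is_derive1_comp _ sin (fun x => c * x)).
by apply: (is_derive_eq (is_deriveZ _ _)); rewrite /GRing.scale/= mulr1.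
Qed.

Let sin_natpi n : sin (n%:R * pi) = 0 :> R.
Proof.
by apply/eqP; rewrite -normr_le0 (le_trans (norm_sin_natM _ _))// sinpi normr0 mulr0.
Qed.

Let cos_oddpi n : cos (n.*2.+1%:R * pi) = -1 :> R.
Proof.
elim: n => [|n IH]; first by rewrite mul1r cospi.
rewrite doubleS (_ : _ * pi = n.*2.+1%:R * pi + pi *+ 2); first by rewrite cosD2pi.
by rewrite -[n.*2.+3]addn2 natrD mulrDl [2%:R * pi]mulr_natl.
Qed.

Lemma int0pi_cos n : (0 < n)%N -> int0pi (fun x => cos (n%:R * x)) 0.
Proof.
move=> n0; exists (n%:R^-1 *: (fun x => sin (n%:R * x))).
  move=> x; apply: (is_derive_eq (is_deriveZ n%:R^-1 (dsin n%:R x))).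
  by rewrite /GRing.scale/= mulrCA mulVf ?mulr1// pnatr_eq0 -lt0n.
by rewrite !fctE sin_natpi mulr0 sin0 subrr.
Qed.

Lemma int0pi_sin n : int0pi (fun x => sin (n.*2.+1%:R * x)) (2 / n.*2.+1%:R).
Proof.
set m := n.*2.+1; exists (- m%:R^-1 *: (fun x => cos (m%:R * x))).
  move=> x; apply: (is_derive_eq (is_deriveZ (- m%:R^-1) (dcos m%:R x))).
  by rewrite /GRing.scale/=; field; rewrite pnatr_eq0.
rewrite !fctE cos_oddpi mulr0 cos0 /GRing.scale/=; ring.
Qed.

Let int0pi_cosB i j : i != j ->
  int0pi (fun x => cos (i%:R * x - j%:R * x)) 0.
Proof.
wlog ij : i j / (j < i)%N => [wl|] nij.
  have [ij|] := ltnP j i; first exact: wl.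
  rewrite leq_eqVlt (negbTE nij)/= => ij.
  rewrite eq_sym in nij; apply: int0pi_eq _ _ (wl j i ij nij) => //.
  by move=> x; rewrite -opprB cosN.
have := @int0pi_cos (i - j); rewrite subn_gt0 => /(_ ij); apply: int0pi_eq => // x.
by rewrite natrB ?(ltnW ij)// mulrBl.
Qed.

Lemma int0pi_sin_sin i j : (0 < i)%N ->
  int0pi (fun x => sin (i%:R * x) * sin (j%:R * x)) (pi / 2 *+ (i == j)).
Proof.
move=> i0; have cD : int0pi (fun x => cos (i%:R * x + j%:R * x)) 0.
  have := @int0pi_cos (i + j); rewrite addn_gt0 i0 => /(_ isT).
  by apply: int0pi_eq => // x; rewrite natrD mulrDl.
have cB : int0pi (fun x => cos (i%:R * x - j%:R * x)) (pi *+ (i == j)).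
  have [<-|/int0pi_cosB//] := eqVneq i j.
  exists id; last by rewrite subr0.
  by move=> x; rewrite subrr cos0; exact: is_derive_id.
have := int0piD _ _ _ _ (int0piZ _ (2^-1) _ cB) (int0piZ _ (- 2^-1) _ cD).
apply: int0pi_eq => [x|]; last by rewrite mulr0 addr0 mulrC mulrnAl.
by rewrite cosB cosD; field.
Qed.

(** The sine sum plus [G] and the weight [W] are both nonnegative on [0, pi], so their product has
    nonnegative integral; by orthogonality only the coefficients of index 0 and [k] survive. *)
Lemma odd_sine_coef_ge0 K k (alpha : nat -> R) G s : (0 < k < K)%N -> s ^+ 2 = 1 ->
  (forall x, 0 <= x <= pi -> - G <= \sum_(j < K) alpha j * sin (j.*2.+1%:R * x)) ->
  0 <= pi / 2 * (k.*2.+1%:R * alpha 0%N + s * alpha k)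
       + G * (2 * k.*2.+1%:R + 2 * s / k.*2.+1%:R).
Proof.
move=> /andP[k0 kK] s2 hG; set m := k.*2.+1.
have s1 : `|s| = 1.
  by move/eqP: s2; rewrite sqrf_eq1 => /orP[]/eqP ->; rewrite ?normrN normr1.
pose W x := m%:R * sin (1%:R * x) + s * sin (m%:R * x) : R.
have W0 x : 0 <= x <= pi -> 0 <= W x.
  move=> x0; rewrite /W mul1r -[s * _]opprK subr_ge0.
  have := norm_sin_natM m x; rewrite (ger0_norm (sin_ge0_pi x0)).
  by apply: le_trans; rewrite -[leRHS]mul1r -[X in _ <= X * _]s1 -normrM -normrN ler_norm.
pose f j x := alpha j * (m%:R * (sin (j.*2.+1%:R * x) * sin (1%:R * x))
  + s * (sin (j.*2.+1%:R * x) * sin (m%:R * x))).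
pose v j := alpha j * (m%:R * (pi / 2 *+ (j.*2.+1 == 1)%N)
  + s * (pi / 2 *+ (j.*2.+1 == m))).
have I1 : int0pi (fun x => \sum_(j < K) f j x) (\sum_(j < K) v j).
  apply: int0pi_sum => j.
  by apply/int0piZ/int0piD; apply/int0piZ/int0pi_sin_sin.
have I2 : int0pi W (2 * m%:R + 2 * s / m%:R).
  have := int0piD _ _ _ _ (int0piZ _ m%:R _ (int0pi_sin 0))
    (int0piZ _ s _ (int0pi_sin k)).
  by apply: int0pi_eq => //; rewrite -/m divr1; ring.
have I := int0piD _ _ _ _ I1 (int0piZ _ G _ I2).
have /(_ _)/le_trans := int0pi_ge0 _ _ I; apply.
  move=> x x0; rewrite (_ : _ + _ =
    (\sum_(j < K) alpha j * sin (j.*2.+1%:R * x) + G) * W x).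
    by rewrite mulr_ge0 ?W0// -lerBlDr sub0r hG.
  rewrite mulrDl mulr_suml; congr (_ + _); apply: eq_bigr => j _.
  by rewrite /f /W; ring.
rewrite lerD2r le_eqVlt; apply/orP; left; apply/eqP; rewrite /v.
rewrite (bigD1 (Ordinal (ltn_trans k0 kK)))//= (bigD1 (Ordinal kK))/=; last first.
  by rewrite -(inj_eq val_inj)/= -lt0n.
rewrite big1 ?addr0 => [|j /andP[]].
  have km : (m == 1%N = false) * ((0.*2.+1 == m) = false)%N.
    by rewrite /m; case: (k) k0.
  by rewrite -/m !km eqxx !mulrb; field.
rewrite -!(inj_eq val_inj)/= => j0' jk.
rewrite /m !eqSS double_eq0 (negbTE j0') (inj_eq double_inj) (negbTE jk) /=.
by rewrite !mulr0 addr0 mulr0.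
Qed.

(* The constant 4/3 bounds 4/pi. *)
Lemma odd_sine_coef_bound K k (alpha : nat -> R) G : (0 < k < K)%N -> 0 <= G ->
  (forall x, 0 <= x <= pi -> - G <= \sum_(j < K) alpha j * sin (j.*2.+1%:R * x)) ->
  `|alpha k| <= k.*2.+1%:R * alpha 0%N + 4 / 3 * (k.*2.+1%:R + 3^-1) * G.
Proof.
move=> kK G0 hG; set m := k.*2.+1.
(* Since k >= 1, m >= 3 and the term 2s/m is at most 2/3; this is the source of [3^-1] in the
   bound. *)
have m3 : m%:R^-1 <= 3^-1 :> R.
  rewrite lef_pV2 ?posrE// ler_nat /m.
  by case/andP: kK => + _; case: (k) => // n _; rewrite doubleS.
have m0 : 0 < m%:R :> R by rewrite ltr0n.
have mi0 : 0 < m%:R^-1 :> R by rewrite invr_gt0.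
have h s : `|s| = 1 ->
    - (s * alpha k) <= m%:R * alpha 0%N + 4 / 3 * (m%:R + 3^-1) * G.
  move=> s1; have s2 : s ^+ 2 = 1.
    by rewrite -real_normK ?num_real// s1 expr1n.
  have := odd_sine_coef_ge0 K k alpha G s kK s2 hG; rewrite -/m.
  have Gs : G * (2 * m%:R + 2 * s / m%:R) <= 2 * (G * (m%:R + 3^-1)).
    rewrite mulrCA ler_wpM2l// mulrDr lerD2l -mulrA ler_pM2l// (le_trans _ m3)//.
    by apply: ler_piMl; [exact: ltW|rewrite -s1 ler_norm].
  have Gm : 0 <= G * (m%:R + 3^-1) by rewrite mulr_ge0// addr_ge0 ?ltW// invr_ge0.
  move: (alpha k) (alpha 0%N) (s * alpha k) pi_ge3 Gs Gm => _ u t p3.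
  move=> Gs Gm /le_trans/(_ (lerD (lexx _) Gs)).
  set g := G * _ in Gm *.
  rewrite [4 / 3 * _ * G](_ : _ = 4 / 3 * g); last by rewrite /g; ring.
  set y := _ * u => H; have {}H : 0 <= pi * (y + t) + 4 * g by lra.
  (* Only a lower bound on pi is available: if y + t is nonnegative the claim is immediate, and
     otherwise pi may be replaced by 3. *)
  have [ty|ty] := leP 0 (y + t).
    have : 0 <= 4 / 3 * g by rewrite mulr_ge0.
    lra.
  suff : pi * (y + t) <= 3 * (y + t) by lra.
  by rewrite ler_wnM2r// ltW.
rewrite ler_norml; apply/andP; split.
  by rewrite lerNl; have := h 1; rewrite normr1 mul1r; exact.
by have := h (-1); rewrite normrN1 mulN1r opprK; exact.
Qed.

End SineSeries.

(** * Entire functions with F(x) F(ix) = 1 and the ridge property *)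

Section Core.
Variable R : realType.
Implicit Types (a b : nat -> R) (r s t x y : R).

Definition primitive_seq a n := if n is k.+1 then a k / n%:R else 0 : R.

Lemma diffs_primitive a : pseries_diffs (primitive_seq a) = a.
Proof. by apply/funext => n; rewrite /pseries_diffs/= mulrCA mulfV ?mulr1// pnatr_eq0. Qed.

Lemma entire_primitive a : entire a -> entire (primitive_seq a).
Proof.
move=> ea r; have [K hK] := ea r; have K0 := le_trans (normr_ge0 _) (hK 0%N).
exists (K * `|r|) => -[|n]; first by rewrite mul0r normr0 mulr_ge0.
rewrite /primitive_seq exprS.
rewrite [X in `|X|](_ : _ = a n * r ^+ n * r * n.+1%:R^-1); last by ring.
rewrite 2!normrM (@le_trans _ _ (K * `|r| * 1))//; last by rewrite mulr1.
apply: ler_pM => //; first by rewrite ler_wpM2r.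
by rewrite ger0_norm ?invr_ge0// invf_le1 ?ltr0n// ler1n.
Qed.

Let cos2pin n x : cos (n%:R * (2 * pi) + x) = cos x :> R.
Proof.
by rewrite addrC !mulr_natl (periodicn (@cosD2pi R)).
Qed.

Variable c : nat -> R.
Hypotheses (ec : entire c) (c0 : c 0%N = 1).
Hypotheses (cge0 : forall n, 0 <= c n) (codd : forall n, odd n -> c n = 0).
Hypothesis cinv : forall x, psum c x * psum (cos_part c (pi / 2)) x = 1.
Hypothesis ridge : forall r x,
  psum (cos_part c x) r ^+ 2 + psum (sin_part c x) r ^+ 2
    <= psum c (r * cos x) ^+ 2.

(** Write F for the sum of [c]. On the real line [ct] sums to F(ix), which is real because odd
    coefficients vanish and equals 1/F(x) by [cinv]. Hence [b] is the series of F'/F and [g] that of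
    log F. *)
Let ct := cos_part c (pi / 2).
Let ect : entire ct := entire_cos_part _ _ _ ec.
Let b := conv (pseries_diffs c) ct.
Let eb : entire b := entire_conv _ _ _ (entire_diffs _ _ ec) ect.
Let g := primitive_seq b.
Let eg : entire g := entire_primitive _ eb.

Let cg : pseries_diffs c =1 conv (pseries_diffs g) c.
Proof.
rewrite diffs_primitive; apply: psum_inj => [||x].
- exact: entire_diffs.
- exact: entire_conv.
- rewrite -psumM// -psumM//; last exact: entire_diffs.
  by rewrite -mulrA [X in _ * X]mulrC cinv mulr1.
Qed.

Let normc x r :
  psum (cos_part c x) r ^+ 2 + psum (sin_part c x) r ^+ 2
    = expR (psum (cos_part g x) r) ^+ 2.
Proof.
rewrite (psum_cos_part_exp _ _ _ x ec eg c0 erefl cg).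
rewrite (psum_sin_part_exp _ _ _ x ec eg c0 erefl cg).
by rewrite !exprMn -mulrDr cos2Dsin2 mulr1.
Qed.

Let psum_exp x : psum c x = expR (psum g x).
Proof.
have cp a : cos_part a 0 = a.
  by apply/funext => n; rewrite /cos_part mulr0 cos0 mulr1.
have sp a : sin_part a 0 = fun=> 0.
  by apply/funext => n; rewrite /sin_part mulr0 sin0 mulr0.
rewrite -{1}(cp c) (psum_cos_part_exp _ _ _ 0 ec eg c0 erefl cg).
by rewrite cp sp psum_cst0 cos0 mulr1.
Qed.

Let log_ridge r x : psum (cos_part g x) r <= psum g (r * cos x).
Proof.
have := ridge r x; rewrite normc psum_exp ler_sqr ?nnegrE ?expR_ge0//.
by rewrite ler_expR.
Qed.

(** For even [n] one of i + 1 and n - i is odd, so every product contains an odd coefficient of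
    [c]. *)
Let b_even n : ~~ odd n -> b n = 0.
Proof.
move=> on; rewrite /b /conv big1// => i _; rewrite /pseries_diffs /ct /cos_part.
have [oi|oi] := boolP (odd i); last by rewrite codd//= ?mulr0 ?mul0r.
have ni : (i <= n)%N by rewrite -ltnS.
by rewrite [X in _ * (X * _)](codd (n - i)) ?oddB ?(negbTE on) ?oi// mul0r mulr0.
Qed.

(** Differentiating F(x) F(ix) = 1 shows that the two Cauchy products of the product rule add up to
    0. When n + 1 is a multiple of 4, the angles (n - i) pi/2 and -(i + 1) pi/2 differ by a multiple
    of 2 pi, so after reversing the index the two products agree and each is 0. *)
Let b_3mod4 k : b (4 * k + 3)%N = 0.
Proof.
set n := (4 * k + 3)%N.
have s0 : (fun n => b n + conv c (pseries_diffs ct) n) =1 fun=> 0.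
  have ed := entire_conv _ _ _ ec (entire_diffs _ _ ect).
  apply: psum_inj => [||x]; first exact: entireD.
    by move=> ?; exists 0 => ?; rewrite mul0r normr0.
  rewrite psum_cst0 psumD// -!psumM//; try exact: entire_diffs.
  have D := is_deriveM (is_derive_psum _ _ x ec) (is_derive_psum _ _ x ect).
  have D1 := is_derive_cst (1 : R) x (1 : R).
  have E : psum c * psum ct = cst 1 by apply/funext => y; rewrite fctE cinv.
  rewrite E in D; have := @derive_val _ _ _ _ _ _ _ D.
  rewrite (@derive_val _ _ _ _ _ _ _ D1) /GRing.scale/= => D0.
  rewrite [RHS]D0; ring.
suff bs : conv c (pseries_diffs ct) n = b n.
  by have := s0 n; rewrite bs => /eqP; rewrite -mulr2n mulrn_eq0 => /eqP.
rewrite /b /conv (reindex_inj rev_ord_inj)/=; apply: eq_bigr => i _.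
have ni : (i <= n)%N by rewrite -ltnS.
rewrite !subSS subKn// /pseries_diffs /ct /cos_part.
have -> : (n - i)%N%:R * (pi / 2) = k.+1%:R * (2 * pi) + - (i.+1%:R * (pi / 2)) :> R.
  by rewrite natrB// /n natrD natrM -!natr1; field.
by rewrite cos2pin cosN; ring.
Qed.

Let g_supp n : (n %% 4 != 2)%N -> g n = 0.
Proof.
case: n => [//|n] n4; rewrite /g /primitive_seq.
have [on|on] := boolP (odd n); last by rewrite b_even ?mul0r.
suff -> : n = (4 * (n %/ 4) + 3)%N by rewrite b_3mod4 mul0r.
lia.
Qed.

(** In fact g_2 = c_2, because c_1 = 0 and c_0 = 1. *)
Let g2_ge0 : 0 <= g 2%N.
Proof.
rewrite /g /primitive_seq /b /conv !big_ord_recr big_ord0 /pseries_diffs /ct /cos_part/=.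
rewrite subnn (codd 1%N)// c0 [0%:R * _]mul0r cos0; have := cge0 2; lra.
Qed.

Let Gam t := psum g (Num.sqrt t).

Let psumc_le y s : `|y| <= s -> psum c y <= psum c s.
Proof.
move=> ys; apply: lim_series_le; try exact: is_cvg_pseries.
move=> n; rewrite ler_wpM2l// (le_trans (ler_norm _))// normrX.
by rewrite lerXn2r// nnegrE ?(le_trans _ ys).
Qed.

(** The signs of the coefficients of [g] are not known; monotonicity comes from F, whose
    coefficients are nonnegative, through the logarithm. *)
Let psumg_le y s : `|y| <= s -> psum g y <= psum g s.
Proof. by move=> /psumc_le; rewrite !psum_exp ler_expR. Qed.

Let Gam_ge0 t : 0 <= Gam t.
Proof.
have := psumg_le 0 (Num.sqrt t); rewrite normr0 sqrtr_ge0 psum0 => /(_ isT).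
exact.
Qed.

(** This is g(iz) = -g(z) in real parts: for n = 2 mod 4, adding n pi/2 to the angle n x amounts to
    adding pi. *)
Let log_anti r x : psum (cos_part g (x + pi / 2)) r = - psum (cos_part g x) r.
Proof.
apply/eqP; rewrite -addr_eq0 -psumD; try exact: entire_cos_part.
rewrite (_ : (fun _ => _) = (fun=> 0)) ?psum_cst0//; apply/funext => n.
have [n4|/g_supp g0] := eqVneq (n %% 4)%N 2%N; last by rewrite /cos_part g0; ring.
rewrite /cos_part mulrDr cosD (_ : n%:R * (pi / 2) = (n %/ 4)%:R * (2 * pi) + pi).
  rewrite cos2pin cospi [sin (_ * (2 * pi) + _)](_ : _ = 0) ?mulr0; first by ring.
  rewrite sinDpi mulr_natl -[in LHS](add0r (_ *+ _)) [2 * pi]mulr_natl.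
  by rewrite (periodicn (@sinD2pi R)) sin0 oppr0.
by rewrite {1}(divn_eq n 4) n4 natrD natrM; field.
Qed.

(** The ridge upper bound in the direction turned by pi/2 becomes a lower bound after the sign
    change of [log_anti]. *)
Let log_lower r s x : `|r * sin x| <= s -> - psum g s <= psum (cos_part g x) r.
Proof.
move=> rs; rewrite lerNl -log_anti (le_trans (log_ridge _ _))// psumg_le//.
by rewrite cosDpihalf mulrN normrN.
Qed.

Let partial4 (F : nat -> R) K : (forall n, (n %% 4 != 2)%N -> F n = 0) ->
  \sum_(0 <= n < 4 * K) F n = \sum_(j < K) F (4 * j + 2)%N.
Proof.
move=> F0; elim: K => [|K IH]; first by rewrite muln0 big_nil big_ord0.
rewrite mulnS addnC !addnS addn0 !big_nat_recr//= IH big_ord_recr/=.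
rewrite (F0 (4 * K)%N) ?(F0 (4 * K).+1) ?(F0 (4 * K).+3) ?addr0; try lia.
by rewrite addn2.
Qed.

(** With m = 2j + 1 the angle is m pi/2 - m x, so the odd multiple of pi/2 turns the cosine into a
    signed sine: on this arc the series becomes an odd sine series. *)
Let cos_arc j x :
  cos ((4 * j + 2)%N%:R * (pi / 4 - x / 2)) = (-1) ^+ j * sin (j.*2.+1%:R * x) :> R.
Proof.
rewrite [X in cos X](_ : _ = - (j.*2.+1%:R * x - pi / 2) + pi *+ j).
  by rewrite (alternatingn (@cosDpi R)) cosN cosBpihalf.
have -> : (4 * j + 2)%N%:R = 4 * j%:R + 2 :> R by rewrite natrD natrM.
have -> : j.*2.+1%:R = 2 * j%:R + 1 :> R by rewrite -natr1 -muln2 natrM mulrC.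
by rewrite -[pi *+ j]mulr_natl; field.
Qed.

(** The sine estimate concerns finite sums, so the series is truncated with an error [e] uniform in
    the angle, which is added to the lower bound. *)
Let coef_bound_eps K k t : 0 <= t -> (0 < k < K)%N -> forall e,
  (forall x, `|psum (cos_part g x) (Num.sqrt (2 * t)) -
     \sum_(0 <= n < 4 * K) cos_part g x n * Num.sqrt (2 * t) ^+ n| <= e) ->
  `|g (4 * k + 2)%N| * (2 * t) ^+ k.*2.+1 <=
    k.*2.+1%:R * (g 2%N * (2 * t)) + 4 / 3 * (k.*2.+1%:R + 3^-1) * (Gam t + e).
Proof.
move=> t0 kK e he; set r := Num.sqrt (2 * t).
have r2 : r ^+ 2 = 2 * t by rewrite sqr_sqrtr// mulr_ge0.
have r42 j : r ^+ (4 * j + 2) = (2 * t) ^+ j.*2.+1.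
  by rewrite -r2 -exprM; congr (_ ^+ _); lia.
pose alpha j := g (4 * j + 2)%N * (-1) ^+ j * (2 * t) ^+ j.*2.+1.
have e0 : 0 <= e := le_trans (normr_ge0 _) (he 0).
have := @odd_sine_coef_bound R K k alpha (Gam t + e) kK (addr_ge0 (Gam_ge0 t) e0).
rewrite /alpha muln0 add0n mulr1 expr1 !normrM normrX normrN1 expr1n mulr1.
rewrite [`|(2 * t) ^+ _|]ger0_norm ?exprn_ge0 ?mulr_ge0//; apply => x x0.
pose y := pi / 4 - x / 2.
have -> : \sum_(j < K) g (4 * j + 2)%N * (-1) ^+ j * (2 * t) ^+ j.*2.+1
      * sin (j.*2.+1%:R * x) = \sum_(0 <= n < 4 * K) cos_part g y n * r ^+ n.
  rewrite (partial4 (fun n => cos_part g y n * r ^+ n)).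
    by apply: eq_bigr => j _; rewrite /cos_part r42 /y cos_arc; ring.
  by move=> n /g_supp gn; rewrite /cos_part gn !mul0r.
have ly : - Gam t <= psum (cos_part g y) r.
  apply: log_lower; rewrite -ler_sqr ?nnegrE ?sqrtr_ge0//.
  rewrite sqr_sqrtr// real_normK ?num_real// exprMn r2.
  (* Since 2y = pi/2 - x, r^2 sin^2 y = t (1 - sin x) <= t; hence the radius sqrt(2t) for a lower
     bound by [Gam t]. *)
  have : cos (y *+ 2) = 1 - sin y ^+ 2 *+ 2.
    by rewrite cos_mulr2n cos2sin2; ring.
  rewrite (_ : y *+ 2 = - (x - pi / 2)); last by rewrite /y; field.
  rewrite cosN cosBpihalf => sxy.
  have sx := sin_ge0_pi x0.
  have : sin y ^+ 2 *+ 2 <= 1 by lra.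
  rewrite -mulr_natl => h.
  rewrite (_ : 2 * t * sin y ^+ 2 = t * (2 * sin y ^+ 2)); last by ring.
  by rewrite ler_piMr.
have := he y; rewrite ler_norml -/r => /andP[h1 h2]; lra.
Qed.

Let geom_tail t : exists2 L, 0 <= L & forall K x,
  `|psum (cos_part g x) (Num.sqrt t) -
     \sum_(0 <= n < K) cos_part g x n * Num.sqrt t ^+ n| <= L * 2^-1 ^+ K.
Proof.
have [L L0 hL] := entire_half _ g (Num.sqrt t) eg.
exists (2 * L) => [|K x]; first by rewrite mulr_ge0.
apply: psum_tail => //; first exact: entire_cos_part.
move=> n; rewrite (le_trans _ (hL n))// /cos_part !normrM ler_wpM2r//.
by rewrite ler_piMr// cos_max.
Qed.

Let le_eps (x y L : R) k :
  (forall K, (k < K)%N -> x <= y + L * 2^-1 ^+ (4 * K)) -> x <= y.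
Proof.
move=> h; have cL : y + L * 2^-1 ^+ (4 * K) @[K --> \oo] --> y.
  rewrite -[X in _ --> X]addr0; apply: cvgD; first exact: cvg_cst.
  under eq_fun do rewrite exprM.
  apply: cvg_geometric.
  by rewrite ger0_norm ?exprn_ge0// exprn_ilt1// ?invr_ge0// invf_lt1// ltr1n.
rewrite -(cvg_lim (@Rhausdorff R) cL); apply: limr_ge; first by apply: cvgP cL.
by near=> K; apply: h; near: K; exact: nbhs_infty_gt.
Unshelve. all: end_near. Qed.

Let coef_bound k t : 0 <= t -> (0 < k)%N ->
  `|g (4 * k + 2)%N| * (2 * t) ^+ k.*2.+1 <=
    k.*2.+1%:R * (g 2%N * (2 * t)) + 4 / 3 * (k.*2.+1%:R + 3^-1) * Gam t.
Proof.
move=> t0 k0; have [L L0 hL] := geom_tail (2 * t).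
apply: (le_eps _ _ (4 / 3 * (k.*2.+1%:R + 3^-1) * L) k) => K kK.
have := coef_bound_eps K k t t0; rewrite k0 kK => /(_ isT _ (hL (4 * K)%N)).
move=> H; apply: le_trans H _.
by rewrite le_eqVlt; apply/orP; left; apply/eqP; ring.
Qed.

(** Sums of 2^-m and m 2^-m over odd m >= 3, with limits 1/6 and 11/18. The exact remainders let the
    induction close and are later dropped by sign. *)
Let sum_weights K :
  \sum_(j < K) 2^-1 ^+ j.+1.*2.+1 = 6^-1 - 2^-1 ^+ K.+1.*2.+1 * (4 / 3) :> R /\
  \sum_(j < K) j.+1.*2.+1%:R * 2^-1 ^+ j.+1.*2.+1 =
    11 / 18 - 2^-1 ^+ K.+1.*2.+1 * (8 / 3 * K.+1%:R + 20 / 9) :> R.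
Proof.
have p j : 2^-1 ^+ j.+1.*2.+1 = 2^-1 ^+ j.*2.+1 / 4 :> R.
  by rewrite doubleS !exprS; field.
elim: K => [|K [IH1 IH2]]; first by rewrite !big_ord0 p expr1; split; field.
rewrite !big_ord_recr/= IH1 IH2 (p K.+1); move: (2^-1 ^+ _) => q.
have -> : K.+1.*2.+1%:R = 2 * K.+1%:R + 1 :> R by rewrite -natr1 -muln2 natrM mulrC.
by rewrite -[K.+2%:R]natr1; split; field.
Qed.

(** With u = g_2 t, the coefficient bounds divided by 2^m add up to (11/9) u + (8/9) Gam. Adding the
    leading term u and absorbing (8/9) Gam on the left multiplies the rest by 9: (20/9) u becomes 20
    u, and the tail becomes 9 L. *)
Let Gam_le t : 0 <= t -> Gam t <= 20 * (g 2%N * t).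
Proof.
move=> t0; have [L L0 hL] := geom_tail t.
have g2t : 0 <= g 2%N * t by rewrite mulr_ge0.
apply: (le_eps _ _ (9 * L) 0) => -[//|K] _.
have s42 j : Num.sqrt t ^+ (4 * j + 2) = t ^+ j.*2.+1.
  rewrite (_ : 4 * j + 2 = 2 * j.*2.+1)%N ?exprM ?sqr_sqrtr//; lia.
pose B := \sum_(j < K) `|g (4 * j.+1 + 2)%N| * t ^+ j.+1.*2.+1.
have GB : Gam t <= g 2%N * t + B + L * 2^-1 ^+ (4 * K.+1).
  have := hL (4 * K.+1)%N 0; rewrite ler_norml => /andP[_].
  rewrite (partial4 (fun n => cos_part g 0 n * Num.sqrt t ^+ n)); last first.
    by move=> n /g_supp gn; rewrite /cos_part gn !mul0r.
  rewrite big_ord_recl muln0 add0n (s42 0%N) expr1.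
  have -> : cos_part g 0 = g.
    by apply/funext => n; rewrite /cos_part mulr0 cos0 mulr1.
  rewrite -/(Gam t) lerBlDl => /le_trans; apply; rewrite lerD2r lerD2l.
  apply: ler_sum => j _; by rewrite s42 ler_wpM2r ?exprn_ge0// ler_norm.
have BG : B <= 11 / 9 * (g 2%N * t) + 8 / 9 * Gam t.
  have [S1 S2] := sum_weights K.
  pose S := \sum_(j < K)
    (j.+1.*2.+1%:R * 2^-1 ^+ j.+1.*2.+1 * (2 * (g 2%N * t) + 4 / 3 * Gam t)
     + 2^-1 ^+ j.+1.*2.+1 * (4 / 9 * Gam t)).
  have BS : B <= S.
    apply: ler_sum => i _; have := coef_bound i.+1 t t0 isT.
    set m := i.+1.*2.+1; rewrite exprMn mulrCA -ler_pdivlMl ?exprn_gt0//.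
    move=> /le_trans; apply; rewrite -exprVn le_eqVlt; apply/orP; left; apply/eqP.
    by field.
  apply: (le_trans BS); rewrite /S big_split/= -!mulr_suml S1 S2.
  have a0 : 0 <= 2^-1 ^+ K.+1.*2.+1 * (8 / 3 * K.+1%:R + 20 / 9) :> R.
    by rewrite mulr_ge0 ?exprn_ge0 ?addr_ge0 ?mulr_ge0.
  have b0 : 0 <= 2^-1 ^+ K.+1.*2.+1 * (4 / 3) :> R by rewrite mulr_ge0 ?exprn_ge0.
  move: (_ * (_ + 20 / 9)) a0 (_ ^+ _ * _) b0 => a a0 v b0.
  move: (g 2%N * t) (Gam t) g2t (Gam_ge0 t) => u G u0 G0.
  have := mulr_ge0 a0 u0; have := mulr_ge0 a0 G0; have := mulr_ge0 b0 G0.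
  by lra.
lra.
Qed.

(** Combining [coef_bound] with [Gam_le], |g_n| (2t)^m <= C t with m >= 3, which forces g_n = 0 as t
    grows. *)
Let g_eq0 n : n != 2%N -> g n = 0.
Proof.
have [n4|/g_supp//] := eqVneq (n %% 4)%N 2%N => n2.
pose k := (n %/ 4)%N.
have k0 : (0 < k)%N by rewrite /k; lia.
have -> : n = (4 * k + 2)%N by rewrite /k; lia.
pose C := k.*2.+1%:R * (g 2%N * 2) + 4 / 3 * (k.*2.+1%:R + 3^-1) * (20 * g 2%N).
have m13 : 0 <= 4 / 3 * (k.*2.+1%:R + 3^-1) :> R by rewrite mulr_ge0// addr_ge0.
have C0 : 0 <= C.
  apply: addr_ge0; first by rewrite mulr_ge0// mulr_ge0.
  by rewrite mulr_ge0// mulr_ge0.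
have h t : 1 <= t -> `|g (4 * k + 2)%N| * t <= C.
  move=> t1; have t0 : 0 < t by rewrite (lt_le_trans ltr01).
  have := coef_bound k t (ltW t0) k0.
  move=> /le_trans/(_ (lerD (lexx _) (ler_wpM2l m13 (Gam_le t (ltW t0))))).
  rewrite (_ : _ + _ = C * t) => [|]; last by rewrite /C; ring.
  move=> H; rewrite -(ler_pM2r t0); apply: le_trans H.
  rewrite -mulrA ler_wpM2l//.
  rewrite (@le_trans _ _ (t ^+ k.*2.+1))//.
    by rewrite -expr2 ler_weXn2l//; move: k0; case: (k).
  by rewrite lerXn2r ?nnegrE ?mulr_ge0 ?(ltW t0)// ler_peMl ?(ltW t0)// ler1n.
(* At t = C / |g_n| + 1 the bound |g_n| t <= C would read C + |g_n| <= C. *)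
apply/eqP; rewrite -normr_le0 leNgt; apply/negP => gk.
have := h (C / `|g (4 * k + 2)%N| + 1).
rewrite lerDr divr_ge0// => /(_ isT).
rewrite mulrDr mulrCA mulfV ?gt_eqF// !mulr1 -lerBrDl subrr leNgt gk.
by [].
Qed.

Theorem entire_conj_inverse_quadratic :
  exists2 q, 0 <= q & forall x, psum c x = expR (q * x ^+ 2).
Proof.
by exists (g 2%N) => // x; rewrite psum_exp (psum_monomial _ _ 2%N _ g_eq0).
Qed.

End Core.

(** * Moment generating functions *)

Section ExpSeq.
Variable R : realType.
Implicit Types (a b : nat -> R) (r s t x y : R).

Definition exp_seq y n := y ^+ n / n`!%:R : R.

Lemma norm_exp_seq_le y n r : `|exp_seq y n * r ^+ n| <= expR `|y * r|.
Proof.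
rewrite /exp_seq mulrAC -exprMn normrM normrX normfV normr_nat.
case: n => [|n]; first by rewrite expr0 mul1r invr1 -expR0 ler_expR.
by rewrite (le_trans _ (expR_ge1Dxn n _))// lerDr.
Qed.

Lemma entire_exp_seq y : entire (exp_seq y).
Proof. by move=> r; exists (expR `|y * r|) => n; exact: norm_exp_seq_le. Qed.

(** A bound uniform in [N]: the dominating function for exchanging sum and expectation. Allowing
    bounded multipliers [b] covers the cosine and sine parts at once. *)
Lemma norm_pseries_exp_seq_le y b r N : (forall n, `|b n| <= 1) ->
  `|pseries (fun n => exp_seq y n * b n) r N| <= expR `|y * r|.
Proof.
move=> b1; apply: (@le_trans _ _ (series (exp_coeff `|y * r|) N)); last first.
  rewrite /expR; apply: nondecreasing_cvgn_le; last exact: is_cvg_series_exp_coeff.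
  apply/nondecreasing_seqP => n; rewrite seriesSr lerDl exp_coeffE.
  by rewrite mulr_ge0 ?invr_ge0// exprn_ge0.
rewrite /pseries/series/= (le_trans (ler_norm_sum _ _ _))// ler_sum// => n _.
rewrite exp_coeffE mulrAC normrM (le_trans (ler_piMr _ (b1 n)))//.
by rewrite /exp_seq mulrAC -exprMn normrM normrX normfV normr_nat mulrC.
Qed.

(** The logarithm of exp(yz), namely the linear series yz; it feeds the ray formulas for
    exponentials. *)
Let id_seq y n := if n == 1%N then y else 0 : R.

Let entire_id_seq y : entire (id_seq y).
Proof.
move=> r; exists `|y * r| => n; rewrite /id_seq.
by case: eqP => [->|]; rewrite ?expr1// mul0r normr0.
Qed.

Let diffs_exp_seq y :
  pseries_diffs (exp_seq y) =1 conv (pseries_diffs (id_seq y)) (exp_seq y).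
Proof.
move=> n; rewrite /conv big_ord_recl big1 => [|i _]; last first.
  by rewrite /pseries_diffs /id_seq/= mulr0 mul0r.
rewrite /pseries_diffs /id_seq/= subn0 addr0 mul1r /exp_seq exprS factS natrM.
by rewrite invfM mulrCA mulVKf ?pnatr_eq0// mulrA.
Qed.

Let exp_seq0 y : exp_seq y 0 = 1.
Proof. by rewrite /exp_seq expr0 divr1. Qed.

Lemma psum_exp_seq_cos y x r :
  psum (cos_part (exp_seq y) x) r = expR (r * cos x * y) * cos (r * sin x * y).
Proof.
rewrite (psum_cos_part_exp _ _ (id_seq y) x (entire_exp_seq y) (entire_id_seq y)
  (exp_seq0 y) erefl (diffs_exp_seq y)).
rewrite !(psum_monomial _ _ 1%N) => [|n|n].
- by rewrite /cos_part /sin_part /id_seq eqxx !mul1r expr1; congr (expR _ * cos _); ring.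
- by rewrite /sin_part /id_seq => /negbTE ->; rewrite mul0r.
- by rewrite /cos_part /id_seq => /negbTE ->; rewrite mul0r.
Qed.

Lemma psum_exp_seq_sin y x r :
  psum (sin_part (exp_seq y) x) r = expR (r * cos x * y) * sin (r * sin x * y).
Proof.
rewrite (psum_sin_part_exp _ _ (id_seq y) x (entire_exp_seq y) (entire_id_seq y)
  (exp_seq0 y) erefl (diffs_exp_seq y)).
rewrite !(psum_monomial _ _ 1%N) => [|n|n].
- by rewrite /cos_part /sin_part /id_seq eqxx !mul1r expr1; congr (expR _ * sin _); ring.
- by rewrite /sin_part /id_seq => /negbTE ->; rewrite mul0r.
- by rewrite /cos_part /id_seq => /negbTE ->; rewrite mul0r.
Qed.

End ExpSeq.

Arguments exp_seq {R} y n.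

Section Moments.
Context d (T : measurableType d) (R : realType) (P : probability T R).
Variable Y : T -> R.
Hypothesis mY : measurable_fun [set: T] Y.
Hypothesis finY : forall s, (\int[P]_w (expR (s * Y w))%:E < +oo)%E.
Implicit Types (r s x : R).

Lemma integrable_expM s : P.-integrable setT (EFin \o (fun w => expR (s * Y w))).
Proof.
apply/integrableP; split.
  by apply/measurable_EFinP; apply: measurableT_comp => //; exact: measurable_funM.
by under eq_integral do rewrite /= ger0_norm ?expR_ge0//.
Qed.

(** exp|a| <= exp(a) + exp(-a). *)
Lemma integrable_expM_norm s : P.-integrable setT (EFin \o (fun w => expR `|Y w * s|)).
Proof.
have i2 := integrableD measurableT (integrable_expM s) (integrable_expM (- s)).
apply: le_integrable i2 => //.
  apply/measurable_EFinP; apply: measurableT_comp => //; apply: measurableT_comp => //.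
  exact: measurable_funM.
move=> w _ /=; rewrite lee_fin [leLHS]ger0_norm ?expR_ge0//.
rewrite [leRHS]ger0_norm ?addr_ge0 ?expR_ge0// [Y w * s]mulrC mulNr.
have [_|_] := ger0P (s * Y w); first by rewrite lerDl expR_ge0.
by rewrite lerDr expR_ge0.
Qed.

Lemma integrable_le_expM (f : T -> R) s : measurable_fun setT f ->
  (forall w, `|f w| <= expR `|Y w * s|) -> P.-integrable setT (EFin \o f).
Proof.
move=> mf fs; apply: le_integrable (integrable_expM_norm s) => //.
  exact/measurable_EFinP.
by move=> w _ /=; rewrite lee_fin [leRHS]ger0_norm ?expR_ge0.
Qed.

(** E[Y^n] / n!, the Taylor coefficients at 0 of the moment generating function. *)
Definition norm_moment n : R := \int[P]_w exp_seq (Y w) n.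

Lemma measurable_exp_seq n : measurable_fun setT (fun w => exp_seq (Y w) n).
Proof. by apply: measurable_funM => //; exact: measurable_funX. Qed.

Lemma integrable_exp_seq n : P.-integrable setT (EFin \o (fun w => exp_seq (Y w) n)).
Proof.
apply: (integrable_le_expM _ 1); first exact: measurable_exp_seq.
by move=> w; have := norm_exp_seq_le _ (Y w) n 1; rewrite expr1n mulr1.
Qed.

Lemma entire_norm_moment : entire norm_moment.
Proof.
move=> r; exists (\int[P]_w expR `|Y w * r|) => n.
rewrite -RintegralZr//; last exact: integrable_exp_seq.
have ir : P.-integrable setT (EFin \o (fun w => exp_seq (Y w) n * r ^+ n)).
  apply: (integrable_le_expM _ r) => [|w]; last exact: norm_exp_seq_le.
  by apply: measurable_funM => //; exact: measurable_exp_seq.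
rewrite (le_trans (le_normr_Rintegral _ ir))// le_Rintegral//.
- exact: integrable_norm.
- exact: integrable_expM_norm.
- by move=> w _; exact: norm_exp_seq_le.
Qed.

Lemma psum_norm_moment (b : nat -> R) r : (forall n, `|b n| <= 1) ->
  psum (fun n => norm_moment n * b n) r =
  \int[P]_w psum (fun n => exp_seq (Y w) n * b n) r.
Proof.
move=> b1.
pose f N w := (pseries (fun n => exp_seq (Y w) n * b n) r N)%:E.
have mf N : measurable_fun setT (f N).
  apply/measurable_EFinP; rewrite /pseries/series/=; apply: measurable_sum => n.
  by do 2 (apply: measurable_funM => //); exact: measurable_exp_seq.
have cf w : f ^~ w @ \oo --> (psum (fun n => exp_seq (Y w) n * b n) r)%:E.
  apply: cvg_EFin; first by near=> n.
  by apply: is_cvg_pseries; apply: entire_mul_bounded => //; exact: entire_exp_seq.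
have mlim : measurable_fun setT (fun w => (psum (fun n => exp_seq (Y w) n * b n) r)%:E).
  by apply: (emeasurable_fun_cvg _ _ mf) => w _; exact: cf.
have ae_cvg : {ae P, forall w, setT w ->
    f ^~ w @ \oo --> (psum (fun n => exp_seq (Y w) n * b n) r)%:E}.
  by apply: aeW => w _; exact: cf.
have ae_le : {ae P, forall w N, setT w -> (`|f N w| <= (expR `|Y w * r|)%:E)%E}.
  by apply: aeW => w N _; rewrite lee_fin norm_pseries_exp_seq_le.
have [ilim _] := dominated_convergence measurableT mf mlim ae_cvg
  (integrable_expM_norm r) ae_le.
have -> : [sequence (\int[P]_w f N w)%E]_N =
    EFin \o pseries (fun n => norm_moment n * b n) r.
  apply/funext => N; rewrite /f /pseries/series/=.
  under eq_integral do rewrite -sumEFin.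
  have ii n : P.-integrable setT (fun w => (exp_seq (Y w) n * b n * r ^+ n)%:E).
    rewrite (_ : (fun _ => _) = (fun w => (b n * r ^+ n)%:E * (exp_seq (Y w) n)%:E))%E.
      by apply: integrableZl => //; exact: integrable_exp_seq.
    by apply/funext => w; rewrite -EFinM; congr EFin; ring.
  rewrite integral_sum// -sumEFin; apply: eq_bigr => n _.
  rewrite -mulrA EFinM (_ : (norm_moment n)%:E = (\int[P]_w (exp_seq (Y w) n)%:E)%E).
    rewrite -integralZr//; last exact: integrable_exp_seq.
    by apply: eq_integral => w _; rewrite -EFinM mulrA.
  by rewrite fineK//; apply: integrable_fin_num => //; exact: integrable_exp_seq.
rewrite -[X in _ --> X](fineK (integrable_fin_num measurableT ilim)).
by move=> /fine_cvgP[_] /cvg_lim; exact.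
Unshelve. all: end_near. Qed.

Lemma psum_norm_moment_cos x r : psum (cos_part norm_moment x) r =
  \int[P]_w (expR (r * cos x * Y w) * cos (r * sin x * Y w)).
Proof.
rewrite psum_norm_moment; last by move=> n; exact: cos_max.
by apply: eq_Rintegral => w _; rewrite -psum_exp_seq_cos.
Qed.

Lemma psum_norm_moment_sin x r : psum (sin_part norm_moment x) r =
  \int[P]_w (expR (r * cos x * Y w) * sin (r * sin x * Y w)).
Proof.
rewrite psum_norm_moment; last by move=> n; exact: sin_max.
by apply: eq_Rintegral => w _; rewrite -psum_exp_seq_sin.
Qed.

Lemma psum_norm_moment_exp s : psum norm_moment s = \int[P]_w expR (s * Y w).
Proof.
have := psum_norm_moment_cos 0 s; rewrite (_ : cos_part _ _ = norm_moment).
  move=> ->; apply: eq_Rintegral => w _.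
  by rewrite cos0 sin0 mulr1 mulr0 mul0r cos0 mulr1.
by apply/funext => n; rewrite /cos_part mulr0 cos0 mulr1.
Qed.

End Moments.

Arguments norm_moment {d T R} P Y n.

Section RealIntegrable.
Context d (T : measurableType d) (R : realType) (P : {measure set T -> \bar R}).

Lemma integrable_scale (k : R) (f : T -> R) : P.-integrable setT (EFin \o f) ->
  P.-integrable setT (EFin \o (fun w => k * f w)).
Proof. by move=> fi; exact: (integrableZl measurableT k fi). Qed.

Lemma integrable_add (f g : T -> R) : P.-integrable setT (EFin \o f) ->
  P.-integrable setT (EFin \o g) -> P.-integrable setT (EFin \o (fun w => f w + g w)).
Proof. by move=> fi gi; exact: (integrableD measurableT fi gi). Qed.

End RealIntegrable.

(** * Quadratic log-Laplace transforms and characteristic functions *)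

Section MomentCharacterization.
Context d (T : measurableType d) (R : realType) (P : probability T R).
Variable Y : T -> R.
Hypothesis mY : measurable_fun [set: T] Y.
Hypothesis finY : forall s, (\int[P]_w (expR (s * Y w))%:E < +oo)%E.
Implicit Types (r s x : R).

Let c := norm_moment P Y.
Let ec : entire c := entire_norm_moment _ _ _ P Y mY finY.

Let c0 : c 0%N = 1.
Proof.
rewrite /c /norm_moment (@eq_Rintegral _ _ _ P setT (cst 1)).
  by rewrite Rintegral_cst// mul1r -[RHS]/(fine 1%E); congr fine; exact: probability_setT.
by move=> w _; rewrite /exp_seq expr0 divr1.
Qed.

Let integrable_exp_trig r s (f : R -> R) : measurable_fun setT f ->
  (forall x, `|f x| <= 1) ->
  P.-integrable setT (EFin \o (fun w => expR (r * Y w) * f (s * Y w))).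
Proof.
move=> mf f1; apply: (integrable_le_expM _ _ _ P Y mY finY _ r).
  apply: measurable_funM; apply: measurableT_comp => //; exact: measurable_funM.
move=> w; rewrite normrM ger0_norm ?expR_ge0// (le_trans (ler_piMr _ (f1 _))) ?expR_ge0//.
by rewrite ler_expR mulrC ler_norm.
Qed.

Let measurable_cosR : measurable_fun [set: R] (@cos R).
Proof. by apply: continuous_measurable_fun; exact: continuous_cos. Qed.

Let measurable_sinR : measurable_fun [set: R] (@sin R).
Proof. by apply: continuous_measurable_fun; exact: continuous_sin. Qed.

(** This is |E exp(zY)| <= E exp(Re z Y). With N the modulus on the left and M the right side, N^2
    is the expectation of exp(uY)(U cos(vY) + V sin(vY)), hence at most N M. *)
Let ridge r x :
  psum (cos_part c x) r ^+ 2 + psum (sin_part c x) r ^+ 2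
    <= psum c (r * cos x) ^+ 2.
Proof.
rewrite /c psum_norm_moment_cos// psum_norm_moment_sin// psum_norm_moment_exp//.
set u := r * cos x; set v := r * sin x.
have iC := integrable_exp_trig u v _ measurable_cosR (@cos_max R).
have iS := integrable_exp_trig u v _ measurable_sinR (@sin_max R).
set U := \int[P]_w (_ * cos _); set V := \int[P]_w (_ * sin _).
set M := \int[P]_w _; have M0 : 0 <= M by apply: Rintegral_ge0 => w _; rewrite expR_ge0.
pose N := Num.sqrt (U ^+ 2 + V ^+ 2).
have N0 : 0 <= N by rewrite sqrtr_ge0.
have N2 : N ^+ 2 = U ^+ 2 + V ^+ 2 by rewrite sqr_sqrtr// addr_ge0 ?sqr_ge0.
rewrite -N2 ler_sqr ?nnegrE//.
have : N * N <= N * M.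
  rewrite -expr2 N2 /M -RintegralZl//; last exact: integrable_expM.
  have -> : U ^+ 2 + V ^+ 2 = \int[P]_w (U * (expR (u * Y w) * cos (v * Y w)) +
      V * (expR (u * Y w) * sin (v * Y w))).
    rewrite RintegralD// ?RintegralZl//; first exact: integrable_scale.
    exact: integrable_scale.
  apply: le_Rintegral => //.
  - by apply: integrable_add; exact: integrable_scale.
  - by apply: integrable_scale; exact: integrable_expM.
  move=> w _; set E := expR _; set a := cos _; set b := sin _.
  rewrite (_ : _ + _ = (U * a + V * b) * E); last by ring.
  rewrite ler_wpM2r ?expR_ge0// (le_trans (ler_norm _))//.
  rewrite -ler_sqr ?nnegrE// real_normK ?num_real// N2 -subr_ge0.
  have ab : a ^+ 2 + b ^+ 2 = 1 by rewrite cos2Dsin2.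
  (* Lagrange's identity, using a^2 + b^2 = 1. *)
  rewrite (_ : _ - _ = (U * b - V * a) ^+ 2) ?sqr_ge0//.
  by rewrite -[U ^+ 2 + V ^+ 2]mulr1 -ab; ring.
have [->//|N_neq0] := eqVneq N 0.
by rewrite ler_pM2l// lt_neqAle eq_sym N_neq0.
Qed.

Let psum_char x : psum (cos_part c (pi / 2)) x = \int[P]_w cos (x * Y w).
Proof.
rewrite /c psum_norm_moment_cos//; apply: eq_Rintegral => w _.
by rewrite cos_pihalf sin_pihalf mulr0 mul0r expR0 mul1r mulr1.
Qed.

Let psum_schar x : psum (sin_part c (pi / 2)) x = \int[P]_w sin (x * Y w).
Proof.
rewrite /c psum_norm_moment_sin//; apply: eq_Rintegral => w _.
by rewrite cos_pihalf sin_pihalf mulr0 mul0r expR0 mul1r mulr1.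
Qed.

Let norm_moment1 : c 1%N = \int[P]_w Y w.
Proof. by apply: eq_Rintegral => w _; rewrite /exp_seq expr1 divr1. Qed.

(** A vanishing sine transform kills the odd moments, and even moments are nonnegative, so the
    moment sequence satisfies all the hypotheses on entire series. *)
Lemma mgf_quadratic_of_product :
  (forall s, \int[P]_w sin (s * Y w) = 0) ->
  (forall s, \int[P]_w expR (s * Y w) * \int[P]_w cos (s * Y w) = 1) ->
  exists2 q, 0 <= q & forall s, \int[P]_w expR (s * Y w) = expR (q * s ^+ 2).
Proof.
move=> sin0 prod1.
have codd n : odd n -> c n = 0.
  move=> on.
  have e0 : entire (fun=> 0 : R) by move=> ?; exists 0 => ?; rewrite mul0r normr0.
  have := psum_inj _ _ _ (entire_sin_part _ _ (pi / 2) ec) e0.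
  move=> /(_ _ n); rewrite /sin_part => cs.
  have {cs}/eqP : c n * sin (n%:R * (pi / 2)) = 0.
    by apply: cs => x; rewrite psum_cst0 -[LHS]/(psum (sin_part _ _) _) psum_schar sin0.
  rewrite mulf_eq0 => /orP[/eqP//|].
  have -> : n%:R * (pi / 2) = pi / 2 + pi *+ n./2 :> R.
    rewrite -{1}(odd_double_half n) on -[nat_of_bool true]/(1%N).
    by rewrite -muln2 natrD natrM -[pi *+ _]mulr_natl; field.
  by rewrite (alternatingn (@sinDpi R)) sin_pihalf mulr1 signr_eq0.
have cge0 n : 0 <= c n.
  have [/codd ->//|en] := boolP (odd n).
  apply: Rintegral_ge0 => w _; rewrite /exp_seq mulr_ge0 ?invr_ge0//.
  by rewrite exprn_even_ge0.
have [|//|q q0 hq] := @entire_conj_inverse_quadratic R c ec c0 cge0 codd.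
  by move=> x; rewrite psum_char psum_norm_moment_exp.
by exists q => // s; rewrite -hq psum_norm_moment_exp.
Qed.

(** Analytic continuation: F' = 2qx F on the real line is an identity of coefficients, so F(z) =
    exp(q z^2) also on the imaginary axis. Its coefficient of index 0 gives the mean. *)
Lemma char_of_mgf_quadratic q :
  (forall s, \int[P]_w expR (s * Y w) = expR (q * s ^+ 2)) ->
  [/\ forall s, \int[P]_w cos (s * Y w) = expR (- (q * s ^+ 2)),
      forall s, \int[P]_w sin (s * Y w) = 0 & \int[P]_w Y w = 0].
Proof.
move=> hq; pose g n : R := if n == 2%N then q else 0.
have eg : entire g.
  move=> r; exists `|q * r ^+ 2| => n; rewrite /g.
  by case: eqP => [->//|]; rewrite mul0r normr0.
have psumc : psum c = (fun s => expR (q * s ^+ 2)).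
  by apply/funext => s; rewrite psum_norm_moment_exp.
have cg : pseries_diffs c =1 conv (pseries_diffs g) c.
  apply: psum_inj => [||x].
  - exact: entire_diffs.
  - by apply: entire_conv => //; exact: entire_diffs.
  rewrite -psumM//; last exact: entire_diffs.
  rewrite (psum_monomial _ (pseries_diffs g) 1%N) => [|n]; last first.
    by rewrite -eqSS => /negbTE n1; rewrite /pseries_diffs /g n1 mulr0.
  have [_ <-] := is_derive_psum _ _ x ec.
  rewrite psumc /pseries_diffs /g/= expr1.
  have D1 : is_derive x 1 (fun s => q * s ^+ 2) (2 * q * x).
    have D0 := is_deriveZ q
      (is_deriveM (is_derive_id (x : R) (1 : R)) (is_derive_id x 1)).
    by apply: (is_derive_eq D0); rewrite /GRing.scale/=; ring.
  have D2 : is_derive x 1 (fun s => expR (q * s ^+ 2)) (expR (q * x ^+ 2) * (2 * q * x)).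
    exact: (@is_derive1_comp _ expR (fun s => q * s ^+ 2)).
  by rewrite (@derive_val _ _ _ _ _ _ _ D2) mulrC.
have pi2 : 2 * (pi / 2) = pi :> R by field.
have gc x : psum (cos_part g (pi / 2)) x = - (q * x ^+ 2).
  rewrite (psum_monomial _ _ 2%N) => [|n].
    by rewrite /cos_part /g eqxx pi2 cospi mulrN1 mulNr.
  by rewrite /cos_part /g => /negbTE ->; rewrite mul0r.
have gs x : psum (sin_part g (pi / 2)) x = 0.
  rewrite (psum_monomial _ _ 2%N) => [|n].
    by rewrite /sin_part /g eqxx pi2 sinpi mulr0 mul0r.
  by rewrite /sin_part /g => /negbTE ->; rewrite mul0r.
split => [s|s|].
- rewrite -psum_char (psum_cos_part_exp _ _ _ _ ec eg c0 erefl cg).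
  by rewrite gc gs cos0 mulr1.
- rewrite -psum_schar (psum_sin_part_exp _ _ _ _ ec eg c0 erefl cg).
  by rewrite gs sin0 mulr0.
- have := cg 0%N; rewrite /conv big_ord1 /pseries_diffs /g/= !mul1r mul0r.
  by rewrite norm_moment1.
Qed.

End MomentCharacterization.

(** * Laws are determined by their characteristic functions *)

Section BoundedConvergence.
Context d (T : measurableType d) (R : realType) (P : probability T R).

Lemma integrable_bounded (f : T -> R) K :
  measurable_fun setT f -> (forall x, `|f x| <= K) ->
  P.-integrable setT (EFin \o f).
Proof.
move=> mf fK; apply: (@le_integrable _ _ _ P setT _ _ (EFin \o cst K)) => //.
- exact/measurable_EFinP.
- by move=> x _ /=; rewrite lee_fin (le_trans (fK x))// ler_norm.
- exact: finite_measure_integrable_cst.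
Qed.

Lemma bounded_cvg_Rintegral (f_ : nat -> T -> R) (f : T -> R) :
  (forall n, measurable_fun setT (f_ n)) -> (forall n x, `|f_ n x| <= 1) ->
  (forall x, f_ n x @[n --> \oo] --> f x) ->
  \int[P]_x f_ n x @[n --> \oo] --> \int[P]_x f x.
Proof.
move=> mf f1 cf.
have mF n : measurable_fun setT (EFin \o f_ n) by exact/measurable_EFinP.
have cF x : (EFin \o f_ n) x @[n --> \oo] --> (EFin \o f) x.
  by apply: cvg_EFin; [exact: nearW|exact: cf].
have mlim : measurable_fun setT (EFin \o f).
  by apply: (emeasurable_fun_cvg _ _ mF) => x _; exact: cF.
have ae_cvg : {ae P, forall x, setT x -> (EFin \o f_ n) x @[n --> \oo] --> (EFin \o f) x}.
  by apply: aeW => x _; exact: cF.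
have ae_le : {ae P, forall x n, setT x -> (`|(EFin \o f_ n) x| <= (EFin \o cst 1%R) x)%E}.
  by apply: aeW => x n _; rewrite lee_fin.
have i1 : P.-integrable setT (EFin \o cst 1) by exact: finite_measure_integrable_cst.
have [ilim _] := dominated_convergence measurableT mF mlim ae_cvg i1 ae_le.
rewrite -[X in _ --> X](fineK (integrable_fin_num measurableT ilim)).
by move=> /fine_cvgP[_]; exact.
Qed.

End BoundedConvergence.

(** * Trigonometric polynomials *)

Section TrigPoly.
Variable R : realType.
Implicit Types (f g : R -> R).
Implicit Types (x y t a b c k u v q : R).

(** The span of all cos(t x + b) with real frequencies: the phase [b] supplies sines, frequency 0
    supplies constants, and product-to-sum formulas give closure under products. *)
Inductive trig_poly : (R -> R) -> Prop :=
| trig_poly_cos t b : trig_poly (fun x => cos (t * x + b))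
| trig_poly_add f g : trig_poly f -> trig_poly g -> trig_poly (fun x => f x + g x)
| trig_poly_scale c f : trig_poly f -> trig_poly (fun x => c * f x).

Lemma eq_trig_poly f g : trig_poly f -> f =1 g -> trig_poly g.
Proof. by move=> fT /funext <-. Qed.

Lemma trig_poly_cst c : trig_poly (fun=> c).
Proof.
apply: (eq_trig_poly _ _ (trig_poly_scale c _ (trig_poly_cos 0 0))) => x.
by rewrite mul0r addr0 cos0 mulr1.
Qed.

Lemma trig_poly_mul f g : trig_poly f -> trig_poly g -> trig_poly (fun x => f x * g x).
Proof.
move=> fT gT; elim: fT => [t b|f1 f2 _ h1 _ h2|c f1 _ h].
- elim: gT => [s e|g1 g2 _ h1 _ h2|c g1 _ h].
  + have h := trig_poly_scale 2^-1 _ (trig_poly_add _ _ (trig_poly_cos (t + s) (b + e))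
      (trig_poly_cos (t - s) (b - e))).
    apply: (eq_trig_poly _ _ h) => x.
    have -> : (t + s) * x + (b + e) = (t * x + b) + (s * x + e) by ring.
    have -> : (t - s) * x + (b - e) = (t * x + b) - (s * x + e) by ring.
    by rewrite cosD cosB; field.
  + by apply: (eq_trig_poly _ _ (trig_poly_add _ _ h1 h2)) => x; rewrite mulrDr.
  + by apply: (eq_trig_poly _ _ (trig_poly_scale c _ h)) => x; rewrite mulrCA.
- by apply: (eq_trig_poly _ _ (trig_poly_add _ _ h1 h2)) => x; rewrite mulrDl.
- by apply: (eq_trig_poly _ _ (trig_poly_scale c _ h)) => x; rewrite mulrA.
Qed.

Lemma trig_poly_exp f n : trig_poly f -> trig_poly (fun x => f x ^+ n).
Proof.
move=> fT; elim: n => [|n IH].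
  by apply: (eq_trig_poly _ _ (trig_poly_cst 1)) => x; rewrite expr0.
by apply: (eq_trig_poly _ _ (trig_poly_mul _ _ fT IH)) => x; rewrite exprS.
Qed.

Lemma trig_poly_onem f : trig_poly f -> trig_poly (fun x => 1 - f x).
Proof.
move=> fT; apply: (eq_trig_poly _ _
  (trig_poly_add _ _ (trig_poly_cst 1) (trig_poly_scale (-1) _ fT))) => x.
by rewrite mulN1r.
Qed.

Lemma trig_poly_sin2 t b : trig_poly (fun x => sin (t * x + b) ^+ 2).
Proof.
have h := trig_poly_scale 2^-1 _ (trig_poly_onem _ (trig_poly_cos (2 * t) (2 * b))).
apply: (eq_trig_poly _ _ h) => x.
have -> : 2 * t * x + 2 * b = (t * x + b) *+ 2 by rewrite -mulr_natl; ring.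
by rewrite cos_mulr2n cos2sin2; field.
Qed.

Lemma measurable_trig_poly f : trig_poly f -> measurable_fun setT f.
Proof.
elim=> [t b|f1 f2 _ h1 _ h2|c f1 _ h].
- apply: measurableT_comp; last by apply: measurable_funD => //; exact: measurable_funM.
  by apply: continuous_measurable_fun; exact: continuous_cos.
- exact: measurable_funD.
- exact: measurable_funM.
Qed.

Lemma bounded_trig_poly f : trig_poly f -> exists K, forall x, `|f x| <= K.
Proof.
elim=> [t b|f1 f2 _ [K hK] _ [L hL]|c f1 _ [K hK]].
- by exists 1 => x; exact: cos_max.
- by exists (K + L) => x; rewrite (le_trans (ler_normD _ _))// lerD.
- by exists (`|c| * K) => x; rewrite normrM ler_wpM2l.
Qed.

End TrigPoly.

Arguments trig_poly {R} f.

Section Threshold.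
Variable R : realType.
Implicit Types (c u v q : R).

Lemma bernoulli_ineq u m : -1 <= u -> 1 + m%:R * u <= (1 + u) ^+ m.
Proof.
move=> u1; elim: m => [|m IH]; first by rewrite mul0r addr0 expr0.
rewrite exprS; have h : 0 <= 1 + u by lra.
apply: le_trans (ler_wpM2l h IH); rewrite -natr1 -subr_ge0.
rewrite (_ : _ - _ = m%:R * u ^+ 2); last by ring.
by rewrite mulr_ge0 ?sqr_ge0.
Qed.

(** Upper companion of Bernoulli's inequality, from (1 - u)(1 + (m + 1)u) = 1 + m u - (m + 1)
    u^2. *)
Lemma onem_exp_le u m : 0 <= u <= 1 -> (1 - u) ^+ m * (1 + m%:R * u) <= 1.
Proof.
move=> /andP[u0 u1]; elim: m => [|m IH]; first by rewrite mul0r addr0 expr0 mulr1.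
apply: le_trans IH; rewrite exprSr -mulrA ler_wpM2l ?exprn_ge0 ?subr_ge0//.
rewrite -natr1 -subr_ge0 (_ : _ - _ = (m%:R + 1) * u ^+ 2); last by ring.
by rewrite mulr_ge0 ?sqr_ge0// addr_ge0.
Qed.

(** With p = sqrt q and 1/p = 1 + h, Bernoulli gives n p^n <= 1/h, so n q^n <= p^n / h. The case q =
    0 is apart because p is inverted. *)
Lemma cvg_natM_exp q : 0 <= q -> q < 1 -> n%:R * q ^+ n @[n --> \oo] --> 0.
Proof.
move=> q0 q1; pose p := Num.sqrt q.
have p1 : p < 1 by rewrite -sqrtr1 ltr_sqrt.
have [qz|qz] := eqVneq q 0.
  rewrite [X in X @ _ --> _](_ : _ = cst 0); first exact: cvg_cst.
  by apply/funext => -[|n]; rewrite ?mul0r// qz expr0n mulr0.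
have p0 : 0 < p by rewrite sqrtr_gt0 lt_neqAle eq_sym qz.
pose h := p^-1 - 1.
have h0 : 0 < h by rewrite subr_gt0 invf_gt1.
apply: (@squeeze_cvgr _ _ _ _ (cst 0) (geometric h^-1 p)); last 2 first.
- exact: cvg_cst.
- by apply: cvg_geometric; rewrite ger0_norm// ltW.
apply: nearW => n; rewrite mulr_ge0 ?exprn_ge0//=.
have -> : q ^+ n = p ^+ n * p ^+ n by rewrite -exprMn -expr2 sqr_sqrtr.
rewrite mulrA ler_wpM2r ?exprn_ge0 ?(ltW p0)// -ler_pdivlMr ?exprn_gt0// -exprVn.
rewrite -ler_pdivrMl ?invr_gt0// invrK.
have := @bernoulli_ineq h n; rewrite /h (_ : 1 + (p^-1 - 1) = p^-1); last by ring.
have hm : -1 <= p^-1 - 1 by rewrite lerBrDl subrr invr_ge0 ltW.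
by move=> /(_ hm); rewrite mulrC; apply: le_trans; rewrite lerDr.
Qed.

Definition threshold_exp c n := (n * (Num.truncn (c^-1 ^+ n)).+1)%N.

(* The exponent makes [threshold_exp c n * v ^+ n] tend to 0 for [v < c] and
   dominate [n] for [v >= c]. *)
Lemma cvg_threshold c v : 0 < c -> c <= 1 -> 0 <= v <= 1 ->
  (1 - v ^+ n) ^+ threshold_exp c n @[n --> \oo] --> ((v < c)%R%:R : R).
Proof.
move=> c0 c1 /andP[v0 v1].
have vn n : 0 <= v ^+ n <= 1 by rewrite exprn_ge0//= exprn_ile1.
have cn n : 0 <= c^-1 ^+ n by rewrite exprn_ge0// invr_ge0 ltW.
have [vc|cv] := ltP v c.
  have vc0 : 0 <= v / c by rewrite divr_ge0// ltW.
  have vc1 : v / c < 1 by rewrite ltr_pdivrMr// mul1r.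
  (* The exponent is at most 2n c^-n, so Bernoulli bounds the power below by 1 - 2n (v/c)^n. *)
  have cg : 1 - 2 * (n%:R * (v / c) ^+ n) @[n --> \oo] --> (1 : R).
    rewrite -[X in _ --> X](subr0 1) -[X in _ --> _ - X](mulr0 2).
    by apply: cvgB; [exact: cvg_cst|apply: cvgMl_tmp; exact: cvg_natM_exp].
  apply: (squeeze_cvgr _ cg (cvg_cst (1 : R))); apply: nearW => n.
  have /andP[vn0 vn1] := vn n.
  rewrite exprn_ile1 ?andbT ?subr_ge0//; last by rewrite lerBlDr lerDl.
  have := @bernoulli_ineq (- v ^+ n) (threshold_exp c n).
  rewrite lerN2 vn1 => /(_ isT); apply: le_trans.
  rewrite mulrN lerD2l lerN2 /threshold_exp natrM -mulrA [leRHS]mulrCA ler_wpM2l//.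
  rewrite -natr1 mulrDl mul1r exprMn [2 * _]mulr_natl mulr2n lerD//.
    by rewrite mulrC ler_wpM2l//; have /andP[] := truncn_itv (cn n).
  by rewrite ler_peMr// exprn_ege1// invf_ge1.
(* For v >= c the exponent times v^n is at least n, so [onem_exp_le] bounds the power by 1/(n +
   1). *)
have ch : (n.+1%:R^-1 : R) @[n --> \oo] --> (0 : R) by exact: cvg_harmonic.
apply: (squeeze_cvgr _ (cvg_cst (0 : R)) ch); apply: nearW => n.
have /andP[vn0 vn1] := vn n.
have p0 : 0 <= (1 - v ^+ n) ^+ threshold_exp c n by rewrite exprn_ge0// subr_ge0.
rewrite p0/= -[leRHS]mul1r ler_pdivlMr//.
apply: le_trans (onem_exp_le _ (threshold_exp c n) (vn n)); rewrite ler_wpM2l//.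
rewrite -natr1 addrC lerD2l /threshold_exp natrM -mulrA ler_peMr//.
have tc : c^-1 ^+ n <= (Num.truncn (c^-1 ^+ n)).+1%:R by rewrite ltW// truncnS_gt.
apply: le_trans (ler_wpM2r vn0 tc); rewrite -exprMn exprn_ege1//.
by rewrite mulrC ler_pdivlMr// mul1r.
Qed.

End Threshold.

Arguments threshold_exp {R} c n.

(** * Equality of laws from equality of cosine and sine transforms *)

Section CharUnique.
Context (R : realType) d1 (T1 : measurableType d1) (P : probability T1 R)
  d2 (T2 : measurableType d2) (Q : probability T2 R).
Variables (X : T1 -> R) (Z : T2 -> R).
Hypotheses (mX : measurable_fun setT X) (mZ : measurable_fun setT Z).
Hypothesis XZcos : forall t, \int[P]_w cos (t * X w) = \int[Q]_w cos (t * Z w).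
Hypothesis XZsin : forall t, \int[P]_w sin (t * X w) = \int[Q]_w sin (t * Z w).
Implicit Types (f g : R -> R) (x y t a b c k u v q : R).

Let trig_poly_XZ f : trig_poly f -> \int[P]_w f (X w) = \int[Q]_w f (Z w).
Proof.
have iP g : trig_poly g -> P.-integrable setT (EFin \o (g \o X)).
  move=> tg; have [K hK] := bounded_trig_poly _ _ tg.
  apply: (integrable_bounded _ _ _ _ _ K) => [|w]; last exact: hK.
  by apply: measurableT_comp => //; exact: measurable_trig_poly.
have iQ g : trig_poly g -> Q.-integrable setT (EFin \o (g \o Z)).
  move=> tg; have [K hK] := bounded_trig_poly _ _ tg.
  apply: (integrable_bounded _ _ _ _ _ K) => [|w]; last exact: hK.
  by apply: measurableT_comp => //; exact: measurable_trig_poly.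
elim=> [t b|f1 f2 t1 h1 t2 h2|c f1 t1 h1].
- have tc : trig_poly (fun x => cos (t * x)).
    by apply: (eq_trig_poly _ _ _ (trig_poly_cos _ t 0)) => x; rewrite addr0.
  have ts : trig_poly (fun x => sin (t * x)).
    apply: (eq_trig_poly _ _ _ (trig_poly_cos _ t (- (pi / 2)))) => x.
    by rewrite cosBpihalf.
  have tcb := trig_poly_mul _ _ _ tc (trig_poly_cst _ (cos b)).
  have tsb := trig_poly_mul _ _ _ ts (trig_poly_cst _ (sin b)).
  under eq_Rintegral do rewrite cosD.
  under [RHS]eq_Rintegral do rewrite cosD.
  rewrite (RintegralB measurableT (iP _ tcb) (iP _ tsb)).
  rewrite (RintegralB measurableT (iQ _ tcb) (iQ _ tsb)).
  rewrite (RintegralZr _ measurableT (iP _ tc)) (RintegralZr _ measurableT (iP _ ts)).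
  rewrite (RintegralZr _ measurableT (iQ _ tc)) (RintegralZr _ measurableT (iQ _ ts)).
  by rewrite XZcos XZsin.
- rewrite (RintegralD measurableT (iP _ t1) (iP _ t2)).
  by rewrite (RintegralD measurableT (iQ _ t1) (iQ _ t2)) h1 h2.
- by rewrite !RintegralZl ?h1//; [exact: (iQ _ t1)|exact: (iP _ t1)].
Qed.

Let cvg_XZ (f_ : nat -> R -> R) f :
  (forall n, measurable_fun setT (f_ n)) -> (forall n x, `|f_ n x| <= 1) ->
  (forall x, f_ n x @[n --> \oo] --> f x) ->
  (forall n, \int[P]_x f_ n (X x) = \int[Q]_x f_ n (Z x)) ->
  \int[P]_x f (X x) = \int[Q]_x f (Z x).
Proof.
move=> mf f1 cf PQ.
have cP := bounded_cvg_Rintegral _ _ _ P (fun n w => f_ n (X w)) (fun w => f (X w))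
  (fun n => measurableT_comp (mf n) mX) (fun n w => f1 n (X w)) (fun w => cf (X w)).
have cQ := bounded_cvg_Rintegral _ _ _ Q (fun n w => f_ n (Z w)) (fun w => f (Z w))
  (fun n => measurableT_comp (mf n) mZ) (fun n w => f1 n (Z w)) (fun w => cf (Z w)).
rewrite -(cvg_lim (@Rhausdorff R) cP) -(cvg_lim (@Rhausdorff R) cQ).
by congr (lim (_ @ \oo)); apply/funext.
Qed.

Let indic_sin2_XZ t b c : 0 < c -> c <= 1 ->
  let A := [set x | sin (t * x + b) ^+ 2 < c] in
  \int[P]_w \1_A (X w) = \int[Q]_w \1_A (Z w) :> R.
Proof.
move=> c0 c1 A.
pose f n x : R := (1 - (sin (t * x + b) ^+ 2) ^+ n) ^+ threshold_exp c n.
have tf n : trig_poly (f n).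
  exact/trig_poly_exp/trig_poly_onem/trig_poly_exp/trig_poly_sin2.
have s2 x : 0 <= sin (t * x + b) ^+ 2 <= 1.
  by rewrite sqr_ge0 sin2cos2 lerBlDr lerDl sqr_ge0.
apply: (cvg_XZ f) => [n|n x|x|n].
- exact: measurable_trig_poly.
- have /andP[s0 s1] := s2 x.
  have /andP[h0 h1] : 0 <= 1 - (sin (t * x + b) ^+ 2) ^+ n <= 1.
    by rewrite subr_ge0 exprn_ile1//= lerBlDr lerDl exprn_ge0.
  by rewrite ger0_norm ?exprn_ge0// exprn_ile1.
- rewrite indicE (_ : (x \in A) = (sin (t * x + b) ^+ 2 < c)).
    exact: cvg_threshold.
  by apply/idP/idP => [/set_mem|h]; last exact/mem_set.
- exact: trig_poly_XZ.
Qed.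

Let sin2_lt x y : `|x| <= 1 -> 0 <= y <= 1 -> (sin x ^+ 2 < sin y ^+ 2) = (`|x| < y).
Proof.
move=> x1 /andP[y0 y1].
have p2 := pihalf_ge1 R.
have -> : sin x ^+ 2 = sin `|x| ^+ 2.
  by have [//|_] := ger0P x; rewrite sinN sqrrN.
have s0 (z : R) : 0 <= z -> z <= 1 -> 0 <= sin z.
  move=> z0 z1; apply: sin_ge0_pi; rewrite z0/= (le_trans z1)//.
  by apply: (le_trans _ (pi_ge2 R)); rewrite ler1n.
rewrite ltr_sqr ?nnegrE ?s0//.
have s1 (z : R) : 0 <= z -> z <= 1 -> z \in `[(- (pi / 2)), (pi / 2 : R)].
  move=> z0 z1; rewrite in_itv/=; apply/andP; split; last exact: le_trans p2.
  by apply: le_trans z0; rewrite lerNl oppr0; exact: le_trans p2.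
by rewrite ltr_sin ?s1.
Qed.

Let indic_ball_XZ a c : 0 < c ->
  \int[P]_w \1_(ball a c) (X w) = \int[Q]_w \1_(ball a c) (Z w) :> R.
Proof.
(* Rescaling by N_j = j + J stretches the period to infinity. The choice of [J] keeps c / N_j <= 1,
   where squared sines compare as their arguments do. *)
move=> c0; pose J := (Num.truncn c).+1.
have cJ : c < J%:R by exact: truncnS_gt.
pose N j : R := (j + J)%N%:R.
have cN j : c < N j by rewrite (lt_le_trans cJ)// ler_nat leq_addl.
have N0 j : 0 < N j := lt_trans c0 (cN j).
have cN0 j : 0 < c / N j by rewrite divr_gt0.
have cN1 j : c / N j <= 1 by rewrite ler_pdivrMr// mul1r ltW.
pose A j := [set x | sin ((N j)^-1 * x + - (a / N j)) ^+ 2 < sin (c / N j) ^+ 2].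
have p2 := pihalf_ge1 R.
apply: (cvg_XZ (fun j => \1_(A j))) => [n|n x|x|n].
- apply: measurable_indic.
  have := @measurable_trig_poly R _ (trig_poly_sin2 _ (N n)^-1 (- (a / N n))).
  move=> /(_ measurableT `]-oo, (sin (c / N n) ^+ 2)[%classic (measurable_itv _)).
  by rewrite setTI; congr measurable; apply/seteqP; split => y /=; rewrite in_itv.
- by rewrite indicE; case: (_ \in _); rewrite ?normr1 ?normr0.
(* As soon as |x - a| <= N_j, the periodic set and the ball agree at x: the indicators are
   eventually constant. *)
- apply: cvg_near_cst; near=> j; rewrite !indicE; congr ((nat_of_bool _)%:R).
  have xN : `|x - a| <= N j.
    apply: (@le_trans _ _ j%:R); last by rewrite ler_nat leq_addr.
    by near: j; exact: nbhs_infty_ger.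
  rewrite (_ : (x \in A j) = (`|(x - a) / N j| < c / N j)); last first.
    rewrite -sin2_lt; last 2 first.
    - by rewrite normrM normfV (gtr0_norm (N0 j)) ler_pdivrMr// mul1r.
    - by rewrite (ltW (cN0 j)) cN1.
    have -> : (x - a) / N j = (N j)^-1 * x + - (a / N j) by ring.
    by apply/idP/idP => [/set_mem//|h]; exact/mem_set.
  rewrite normrM normfV (gtr0_norm (N0 j)) ltr_pM2r ?invr_gt0//.
  apply/idP/idP => [h|/set_mem]; last by rewrite /ball/= distrC.
  by apply/mem_set; rewrite /ball/= distrC.
- apply: indic_sin2_XZ.
    rewrite exprn_gt0// sin_gt0_pi// cN0/=.
    by have := cN1 n; lra.
  by rewrite sin2cos2 lerBlDr lerDl sqr_ge0.
Unshelve. all: end_near. Qed.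

(** The ray is the increasing union of the balls (y - 2(j + 1), y). *)
Let indic_ray_XZ y : \int[P]_w \1_`]-oo, y[ (X w) = \int[Q]_w \1_`]-oo, y[ (Z w) :> R.
Proof.
apply: (cvg_XZ (fun j => \1_(ball (y - j.+1%:R) j.+1%:R))) => [n|n x|x|n].
- by apply: measurable_indic; rewrite ball_itv; exact: measurable_itv.
- by rewrite indicE; case: (_ \in _); rewrite ?normr1 ?normr0.
- apply: cvg_near_cst; near=> j; rewrite !indicE; congr ((nat_of_bool _)%:R).
  have h : y - x < j.+1%:R.
    rewrite (le_lt_trans (ler_norm _))// -natr1 ltr_pwDr//.
    by near: j; exact: nbhs_infty_ger.
  have -> : (x \in `]-oo, y[%classic) = (x < y).
    apply/idP/idP => [/set_mem|h']; first by rewrite /= in_itv.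
    by apply/mem_set; rewrite /= in_itv.
  have -> : (x \in (ball (y - j.+1%:R) j.+1%:R : set R)) = (`|y - j.+1%:R - x| < j.+1%:R).
    by apply/idP/idP => [/set_mem//|h']; exact/mem_set.
  rewrite ltr_norml; apply/idP/idP => [/andP[h1 h2]|h1]; first by lra.
  by apply/andP; split; lra.
- exact: indic_ball_XZ.
Unshelve. all: end_near. Qed.

(** Open rays to the left form a generating class closed under intersection, and there the integrals
    of indicators are probabilities. *)
Lemma char_unique (A : set R) : measurable A -> P (X @^-1` A) = Q (Z @^-1` A).
Proof.
pose X' : {mfun T1 >-> R} := HB.pack X (isMeasurableFun.Build _ _ _ _ X mX).
pose Z' : {mfun T2 >-> R} := HB.pack Z (isMeasurableFun.Build _ _ _ _ Z mZ).
move=> mA; rewrite -[LHS]/(distribution P X' A) -[RHS]/(distribution Q Z' A).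
apply: (@measure_unique _ R _ (@RGenInftyO.G R) (fun n => `]-oo, n%:R[%classic)
  _ _ _ _ (distribution P X') (distribution Q Z')) => //.
- exact: RGenInftyO.measurableE.
- move=> _ _ [x ->] [y ->]; exists (Num.min x y).
  by apply/seteqP; split => z /=; rewrite !in_itv/= lt_min => /andP.
- by move=> n; exists n%:R.
- apply/seteqP; split => // x _; exists (Num.truncn x).+1 => //=.
  by rewrite in_itv/= truncnS_gt.
- move=> _ [y ->]; have mr : measurable `]-oo, y[%classic by exact: measurable_itv.
  have mXr : measurable (X @^-1` `]-oo, y[).
    by rewrite -[X in measurable X]setTI; exact: mX.
  have mZr : measurable (Z @^-1` `]-oo, y[).
    by rewrite -[X in measurable X]setTI; exact: mZ.
  have EX : \int[P]_w \1_`]-oo, y[ (X w) = fine (P (X @^-1` `]-oo, y[)) :> R.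
    by rewrite /Rintegral (integral_indic P measurableT mXr) setIT.
  have EZ : \int[Q]_w \1_`]-oo, y[ (Z w) = fine (Q (Z @^-1` `]-oo, y[)) :> R.
    by rewrite /Rintegral (integral_indic Q measurableT mZr) setIT.
  change (P (X @^-1` `]-oo, y[) = Q (Z @^-1` `]-oo, y[)).
  rewrite -[LHS]fineK ?fin_num_measure// -[RHS]fineK ?fin_num_measure//.
  by rewrite -EX -EZ indic_ray_XZ.
- by move=> n; rewrite (le_lt_trans (probability_le1 _ _))// ltry.
Qed.

End CharUnique.

(** * Normal laws *)

Section NormalLaw.
Variable R : realType.
Implicit Types (m s t q : R).
Local Notation leb := (@lebesgue_measure R).

(** The Radon-Nikodym derivative and the Gaussian density have equal integrals over measurable sets,
    so they agree almost everywhere. *)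
Lemma integral_normal_prob m s (f : measurableTypeR R -> \bar R) :
  measurable_fun setT f -> (forall x, 0 <= f x)%E ->
  (\int[normal_prob m s]_x f x = \int[leb]_x (f x * (normal_pdf m s x)%:E))%E.
Proof.
move=> mf f0.
have dom := normal_prob_dominates m s.
rewrite -(Radon_Nikodym_SigmaFinite.change_of_variables dom f0 measurableT mf).
have mRN : measurable_fun setT (Radon_Nikodym_SigmaFinite.f (normal_prob m s) leb).
  exact: measurable_int (Radon_Nikodym_SigmaFinite.f_integrable dom).
have mpdf : measurable_fun setT (fun x : measurableTypeR R => (normal_pdf m s x)%:E).
  by apply/measurable_EFinP; exact: measurable_normal_pdf.
apply: ae_eq_integral => //; try exact: emeasurable_funM.
apply: ae_eqe_mul2l; apply: integral_ae_eq => //.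
  exact: Radon_Nikodym_SigmaFinite.f_integrable.
by move=> A _ mA; rewrite -Radon_Nikodym_SigmaFinite.f_integral.
Qed.

(** Completing the square: the exponential tilt turns the density into a constant times the one with
    mean m + t s^2. *)
Lemma mgf_normal_prob m s t : s != 0 ->
  (\int[normal_prob m s]_x (expR (t * (x - m)))%:E = (expR (s ^+ 2 / 2 * t ^+ 2))%:E)%E.
Proof.
move=> s0; rewrite integral_normal_prob; last 2 first.
- apply/measurable_EFinP; apply: measurableT_comp => //.
  by apply: measurable_funM => //; exact: measurable_funB.
- by move=> x; rewrite lee_fin expR_ge0.
transitivity (\int[leb]_x ((expR (s ^+ 2 / 2 * t ^+ 2))%:E *
    (normal_pdf (m + t * s ^+ 2) s x)%:E))%E.
  apply: eq_integral => x _; rewrite -!EFinM; congr EFin.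
  rewrite !normal_pdfE// /normal_fun mulrCA [RHS]mulrCA -!expRD.
  by congr (_ * expR _); field.
rewrite integralZl//; last exact: integrable_normal_pdf.
by rewrite integral_normal_pdf mule1.
Qed.

End NormalLaw.

Section Laws.
Context d (T : measurableType d) (R : realType) (P : probability T R).
Variable Y : T -> R.
Hypothesis mY : measurable_fun [set: T] Y.
Implicit Types (m s t q : R).

Lemma mgf_normal_law m s : (forall B, measurable B -> P (Y @^-1` B) = normal_law m s B) ->
  forall t, (\int[P]_w (expR (t * (Y w - m)))%:E = (expR (s ^+ 2 / 2 * t ^+ 2))%:E)%E.
Proof.
move=> lawY t; pose f (x : R) := (expR (t * (x - m)))%:E.
have mf : measurable_fun setT f.
  apply/measurable_EFinP; apply: measurableT_comp => //.
  by apply: measurable_funM => //; exact: measurable_funB.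
have f0 x : (0 <= f x)%E by rewrite lee_fin expR_ge0.
have [s0|s0] := eqVneq s 0.
  pose Y' : {mfun T >-> R} := HB.pack Y (isMeasurableFun.Build _ _ _ _ Y mY).
  rewrite -[LHS](ge0_integral_distribution Y' mf f0).
  rewrite (eq_measure_integral (dirac m)) => [|A mA _]; last first.
    by rewrite /= /distribution /pushforward lawY// /normal_law s0 eqxx.
  rewrite integral_dirac// diracT mul1e /f subrr mulr0 s0.
  by rewrite expr0n/= mul0r mul0r.
(* [normal_prob] lives on [measurableTypeR R], whose display differs from that
   of the canonical structure on [R]. *)
pose Y' : {mfun T >-> measurableTypeR R} :=
  HB.pack Y (isMeasurableFun.Build _ _ T (measurableTypeR R) Y mY).
rewrite -(mgf_normal_prob _ m _ t s0) -[LHS](ge0_integral_distribution Y' mf f0).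
apply: eq_measure_integral => A mA _.
by rewrite /= /distribution /pushforward lawY// /normal_law (negbTE s0).
Qed.

(** The transform fixes the characteristic function, hence the law, which is compared with a
    reference variable having the same transform. The scale sqrt(2q) solves s^2 / 2 = q. *)
Lemma normal_law_of_mgf m q : 0 <= q ->
  (forall s, (\int[P]_w (expR (s * Y w))%:E = (expR (q * s ^+ 2))%:E)%E) ->
  forall B, measurable B ->
    P ((fun w => Y w + m) @^-1` B) = normal_law m (Num.sqrt (2 * q)) B.
Proof.
move=> q0 hq B mB.
have fin d' (T' : measurableType d') (P' : probability T' R) (Z : T' -> R) :
    (forall s, (\int[P']_w (expR (s * Z w))%:E = (expR (q * s ^+ 2))%:E)%E) ->
    forall s, (\int[P']_w (expR (s * Z w))%:E < +oo)%E.
  by move=> h s; rewrite h ltry.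
have rq d' (T' : measurableType d') (P' : probability T' R) (Z : T' -> R) :
    (forall s, (\int[P']_w (expR (s * Z w))%:E = (expR (q * s ^+ 2))%:E)%E) ->
    forall s, \int[P']_w expR (s * Z w) = expR (q * s ^+ 2).
  by move=> h s; rewrite /Rintegral h.
have [cY sY _] := char_of_mgf_quadratic _ _ _ P Y mY (fin _ _ _ _ hq) q (rq _ _ _ _ hq).
pose A := (fun x : R => x + m) @^-1` B.
have mA : measurable A.
  rewrite -[A]setTI; apply: (_ : measurable_fun setT (fun x : R => x + m)) => //.
  exact: measurable_funD.
(* It is applied to x - m under the point mass at m when q = 0, and under the normal law otherwise;
   [A] is [B] translated accordingly. *)
have main d' (T' : measurableType d') (Q : probability T' R) (Z : T' -> R) :
    measurable_fun setT Z ->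
    (forall s, (\int[Q]_w (expR (s * Z w))%:E = (expR (q * s ^+ 2))%:E)%E) ->
    P (Y @^-1` A) = Q (Z @^-1` A).
  move=> mZ hZ.
  have [cZ sZ _] := char_of_mgf_quadratic _ _ _ Q Z mZ (fin _ _ _ _ hZ) q (rq _ _ _ _ hZ).
  by apply: char_unique => // t; rewrite ?cY ?cZ ?sY ?sZ.
rewrite -[LHS]/(P (Y @^-1` A)) /normal_law.
have [/eqP|s0] := eqVneq (Num.sqrt (2 * q)) 0.
  rewrite sqrtr_eq0 pmulr_rle0// => q0'.
  have qz : q = 0 by apply/le_anti/andP.
  rewrite (main _ _ (dirac m) (fun x => x - m)).
  - rewrite (_ : (fun x => x - m) @^-1` A = B)//.
    by apply/seteqP; split => x; rewrite /A/= subrK.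
  - exact: measurable_funB.
  - move=> s; rewrite integral_dirac//; last first.
      apply/measurable_EFinP; apply: measurableT_comp => //.
      by apply: measurable_funM => //; exact: measurable_funB.
    by rewrite diracT mul1e subrr mulr0 qz mul0r.
rewrite (main _ _ (normal_prob m (Num.sqrt (2 * q))) (fun x => x - m)).
- by congr (normal_prob _ _ _); apply/seteqP; split => x; rewrite /A/= subrK.
- exact: measurable_funB.
- move=> s; rewrite mgf_normal_prob// sqr_sqrtr ?mulr_ge0//; congr (expR _)%:E.
  by field.
Qed.

End Laws.

(** * Projections of random vectors *)

Local Open Scope complex_scope.

Section Projections.
Context d0 (T : measurableType d0) (R : realType) (P : probability T R) (d : nat).
Variable X : T -> 'cV[R]_d.
Hypothesis X_rv : random_vector X.
Hypothesis X_mgf : forall t : 'cV[R]_d, (mgf P X t < +oo)%E.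
Implicit Types (t mu : 'cV[R]_d) (s m : R).

Lemma dotvE t (x : 'cV[R]_d) : dotv t x = \sum_i t i ord0 * x i ord0.
Proof. by rewrite /dotv mxE; apply: eq_bigr => i _; rewrite mxE. Qed.

Lemma dotvZl s t (x : 'cV[R]_d) : dotv (s *: t) x = s * dotv t x.
Proof. by rewrite !dotvE mulr_sumr; apply: eq_bigr => i _; rewrite mxE mulrA. Qed.

Lemma dotv_delta i (x : 'cV[R]_d) : dotv (delta_mx i ord0) x = x i ord0.
Proof.
rewrite dotvE (bigD1 i)//= big1 ?addr0 => [|j ji]; first by rewrite mxE !eqxx mul1r.
by rewrite mxE (negbTE ji) mul0r.
Qed.

Lemma measurable_dotv t : measurable_fun setT (fun w => dotv t (X w)).
Proof.
under eq_fun do rewrite dotvE.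
by apply: measurable_sum => i; apply: measurable_funM => //; exact: X_rv.
Qed.

Lemma mgf_dotv_lty t s : (\int[P]_w (expR (s * dotv t (X w)))%:E < +oo)%E.
Proof.
have := X_mgf (s *: t); rewrite /mgf expectation.unlock.
by under eq_integral do rewrite dotvZl.
Qed.

Lemma cexp_i (z : R) : cexp ('i * z%:C) = cos z +i* sin z.
Proof. by rewrite /cexp; simpc; rewrite /= expR0; simpc. Qed.

Lemma cexp_i1 (z : R) : cexp (('i + 1) * z%:C) = (expR z * cos z) +i* (expR z * sin z).
Proof. by rewrite /cexp; simpc. Qed.

Lemma characteristic_functionE t : characteristic_function P X t =
  (\int[P]_w cos (dotv t (X w))) +i* (\int[P]_w sin (dotv t (X w))).
Proof.
rewrite /characteristic_function /cexpectation !expectation.unlock /Rintegral.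
by congr (fine _ +i* fine _); apply: eq_integral => w _; rewrite cexp_i.
Qed.

Lemma fine_mgfE t : fine (mgf P X t) = \int[P]_w expR (dotv t (X w)).
Proof. by rewrite /mgf expectation.unlock. Qed.

Lemma char_mgf_identityP t mu :
  characteristic_function P X t * (fine (mgf P X t))%:C
    - cexp (('i + 1) * (dotv t mu)%:C) = 0 <->
  \int[P]_w cos (dotv t (X w)) * \int[P]_w expR (dotv t (X w)) =
    expR (dotv t mu) * cos (dotv t mu) /\
  \int[P]_w sin (dotv t (X w)) * \int[P]_w expR (dotv t (X w)) =
    expR (dotv t mu) * sin (dotv t mu).
Proof.
rewrite characteristic_functionE fine_mgfE cexp_i1; simpc.
split=> [[/subr0_eq -> /subr0_eq ->]//|[-> ->]].
by rewrite !subrr.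
Qed.

Lemma integral_centeredE t m s :
  [/\ \int[P]_w cos (s * (dotv t (X w) - m)) =
        \int[P]_w cos (s * dotv t (X w)) * cos (s * m) +
        \int[P]_w sin (s * dotv t (X w)) * sin (s * m),
      \int[P]_w sin (s * (dotv t (X w) - m)) =
        \int[P]_w sin (s * dotv t (X w)) * cos (s * m) -
        \int[P]_w cos (s * dotv t (X w)) * sin (s * m) &
      (\int[P]_w (expR (s * (dotv t (X w) - m)))%:E =
        (\int[P]_w expR (s * dotv t (X w)) * expR (- (s * m)))%:E)%E].
Proof.
have mt : measurable_fun setT (fun w => s * dotv t (X w)).
  by apply: measurable_funM => //; exact: measurable_dotv.
have ic : P.-integrable setT (EFin \o (fun w => cos (s * dotv t (X w)))).
  apply: (integrable_bounded _ _ _ _ _ 1) => [|w]; last exact: cos_max.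
  apply: measurableT_comp => //.
  by apply: continuous_measurable_fun; exact: continuous_cos.
have is_ : P.-integrable setT (EFin \o (fun w => sin (s * dotv t (X w)))).
  apply: (integrable_bounded _ _ _ _ _ 1) => [|w]; last exact: sin_max.
  apply: measurableT_comp => //.
  by apply: continuous_measurable_fun; exact: continuous_sin.
have ie := integrable_expM _ _ _ P _ (measurable_dotv t) (mgf_dotv_lty t) s.
have scale (f : T -> R) k : P.-integrable setT (EFin \o f) ->
    P.-integrable setT (EFin \o (fun w => f w * k)).
  move=> fi; rewrite (_ : (fun w => f w * k) = (fun w => k * f w)); last first.
    by apply/funext => w; rewrite mulrC.
  exact: integrable_scale.
split.
- rewrite -!RintegralZr// -RintegralD//; try exact: scale.
  by apply: eq_Rintegral => w _; rewrite mulrBr cosB.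
- rewrite -!RintegralZr// -RintegralB//; try exact: scale.
  by apply: eq_Rintegral => w _; rewrite mulrBr sinB.
- rewrite EFinM [X in (X * _)%E]fineK; last exact: integrable_fin_num.
  rewrite -integralZr//; apply: eq_integral => w _.
  by rewrite -EFinM -expRD mulrBr.
Qed.

(** Finite exponential moments make every coordinate integrable, as the normalised moment of order
    1, so linearity applies. *)
Lemma Rintegral_dotv t mu : has_mean P X mu -> \int[P]_w dotv t (X w) = dotv t mu.
Proof.
move=> Xmu.
have iX i : P.-integrable setT (fun w => (t i ord0 * X w i ord0)%:E).
  have i1 := integrable_exp_seq _ _ _ P _ (measurable_dotv (delta_mx i ord0))
    (mgf_dotv_lty (delta_mx i ord0)) 1.
  apply: (integrable_scale _ _ _ P _ (fun w => X w i ord0)).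
  apply: eq_integrable i1 => // w _.
  by rewrite /= /exp_seq expr1 divr1 dotv_delta.
rewrite /Rintegral; under eq_integral do rewrite dotvE -sumEFin.
rewrite integral_sum// dotvE -[RHS]/(fine (_)%:E) -sumEFin; congr fine.
apply: eq_bigr => i _; rewrite EFinM -Xmu expectation.unlock -integralZl//.
have i1 := integrable_exp_seq _ _ _ P _ (measurable_dotv (delta_mx i ord0))
    (mgf_dotv_lty (delta_mx i ord0)) 1.
apply: eq_integrable i1 => // w _.
by rewrite /= /exp_seq expr1 divr1 dotv_delta.
Qed.

End Projections.

(** * The product identity and multivariate normality *)

Theorem proposition2p1 (disp : measure_display) (T : measurableType disp)
    (R : realType) (P : probability T R) (d : nat) (X : T -> 'cV[R]_d)
    (X_rv : random_vector X) (X_nondeg : nondegenerate_vector P X)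
    (X_mgf : forall t : 'cV[R]_d, (mgf P X t < +oo)%E) (mu : 'cV[R]_d) :
  (forall t : 'cV[R]_d,
     characteristic_function P X t * (fine (mgf P X t))%:C
       - cexp (('i + 1) * (dotv t mu)%:C) = 0)
  <-> normal_vector P X /\ has_mean P X mu.
Proof.
have mt t : measurable_fun setT (fun w => dotv t (X w)) by exact: measurable_dotv.
have mY t m : measurable_fun setT (fun w => dotv t (X w) - m) by exact: measurable_funB.
have finY t m s : (\int[P]_w (expR (s * (dotv t (X w) - m)))%:E < +oo)%E.
  by have [_ _ ->] := integral_centeredE _ _ _ P _ _ X_rv X_mgf t m s; rewrite ltry.
have EY t m s := integral_centeredE _ _ _ P _ _ X_rv X_mgf t m s.
have EYR t m s : \int[P]_w expR (s * (dotv t (X w) - m)) =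
    \int[P]_w expR (s * dotv t (X w)) * expR (- (s * m)).
  by rewrite /Rintegral; have [_ _ ->] := EY t m s.
split=> [hid|[normX meanX] t].
  have gauss t : exists2 q, 0 <= q & forall s,
      \int[P]_w expR (s * (dotv t (X w) - dotv t mu)) = expR (q * s ^+ 2).
    set m := dotv t mu.
    (* Applying the vector identity at [s *: t] gives the scalar identity on the whole line for the
       projection on [t]. *)
    have ids s : \int[P]_w cos (s * dotv t (X w)) * \int[P]_w expR (s * dotv t (X w)) =
          expR (s * m) * cos (s * m) /\
        \int[P]_w sin (s * dotv t (X w)) * \int[P]_w expR (s * dotv t (X w)) =
          expR (s * m) * sin (s * m).
      have E (f : R -> R) :
          \int[P]_w f (dotv (s *: t) (X w)) = \int[P]_w f (s * dotv t (X w)).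
        by apply: eq_Rintegral => w _; rewrite dotvZl.
      by have /char_mgf_identityP := hid (s *: t); rewrite dotvZl !E.
    (* Centring multiplies the identity by exp(-sm) and rotates it by -sm: the real part becomes 1,
       and the imaginary part, treated next, becomes 0. *)
    have prod1 s : \int[P]_w expR (s * (dotv t (X w) - m)) *
        \int[P]_w cos (s * (dotv t (X w) - m)) = 1.
      have [-> _ _] := EY t m s; rewrite EYR; have [h1 h2] := ids s.
      move: h1 h2; set C := \int[P]_w cos _; set S := \int[P]_w sin _.
      set M := \int[P]_w expR _ => h1 h2.
      transitivity (expR (- (s * m)) * (C * M * cos (s * m) + S * M * sin (s * m))).
        by ring.
      rewrite h1 h2 -[RHS](expRxMexpNx_1 (s * m)) -[expR (s * m) in RHS]mulr1.
      by rewrite -(cos2Dsin2 (s * m)); ring.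
    have sin0 s : \int[P]_w sin (s * (dotv t (X w) - m)) = 0.
      have p1 := prod1 s.
      have M0 : \int[P]_w expR (s * (dotv t (X w) - m)) != 0.
        by apply: contra_eq_neq p1 => ->; rewrite mul0r eq_sym oner_eq0.
      apply: (mulfI M0); rewrite mulr0.
      have [_ -> _] := EY t m s; rewrite EYR; have [h1 h2] := ids s.
      move: h1 h2; set C := \int[P]_w cos _; set S := \int[P]_w sin _.
      set M := \int[P]_w expR _ => h1 h2.
      transitivity (expR (- (s * m)) * (S * M * cos (s * m) - C * M * sin (s * m))).
        by ring.
      by rewrite h1 h2; ring.
    exact: (mgf_quadratic_of_product _ _ _ P _ (mY t m) (finY t m)).
  split=> [t|i].
    have [q q0 hq] := gauss t.
    exists (dotv t mu), (Num.sqrt (2 * q)); split => [|B mB]; first exact: sqrtr_ge0.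
    rewrite -(normal_law_of_mgf _ _ _ P _ (mY t (dotv t mu)) (dotv t mu) q q0 _ B mB).
      by congr (P _); apply/seteqP; split => w; rewrite /= subrK.
    move=> s; rewrite -hq /Rintegral fineK//.
    apply: integrable_fin_num => //.
    exact: (integrable_expM _ _ _ P _ (mY t _) (finY t _)).
  (* Coordinate [i] is a projection, and its centred version has mean 0 because its transform is
     exp(q s^2). *)
  pose t : 'cV[R]_d := delta_mx i ord0.
  have [q q0 hq] := gauss t.
  have [_ _ m0] := char_of_mgf_quadratic _ _ _ P _ (mY t _) (finY t _) q hq.
  have iX : P.-integrable setT (EFin \o (fun w => dotv t (X w))).
    have i1 := integrable_exp_seq _ _ _ P _ (mt t) (mgf_dotv_lty _ _ _ P _ _ X_mgf t) 1.
    by apply: eq_integrable i1 => // w _; rewrite /= /exp_seq expr1 divr1.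
  move: m0; rewrite RintegralB//; last exact: finite_measure_integrable_cst.
  rewrite Rintegral_cst// [fine _](_ : _ = 1); last first.
    by rewrite -[RHS]/(fine 1%E); congr fine; exact: probability_setT.
  rewrite mulr1 => /subr0_eq; rewrite dotv_delta => <-.
  rewrite expectation.unlock fineK; last exact: integrable_fin_num.
  by apply: eq_integral => w _; rewrite dotv_delta.
have [m [s [s0 law]]] := normX t.
have mg := mgf_normal_law _ _ _ P _ (mt t) m s law.
have mgR u : \int[P]_w expR (u * (dotv t (X w) - m)) = expR (s ^+ 2 / 2 * u ^+ 2).
  by rewrite /Rintegral mg.
have [cosY sinY meanY] := char_of_mgf_quadratic _ _ _ P _ (mY t m) (finY t m) _ mgR.
have iX : P.-integrable setT (EFin \o (fun w => dotv t (X w))).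
  have i1 := integrable_exp_seq _ _ _ P _ (mt t) (mgf_dotv_lty _ _ _ P _ _ X_mgf t) 1.
  by apply: eq_integrable i1 => // w _; rewrite /= /exp_seq expr1 divr1.
(* The centre [m] comes from normality alone; the mean of the projection identifies it. *)
have mE : m = dotv t mu.
  move: meanY; rewrite RintegralB//; last exact: finite_measure_integrable_cst.
  rewrite Rintegral_cst// [fine _](_ : _ = 1); last first.
    by rewrite -[RHS]/(fine 1%E); congr fine; exact: probability_setT.
  by rewrite mulr1 => /subr0_eq <-; exact: Rintegral_dotv.
apply/char_mgf_identityP; rewrite -mE.
have [hc hs _] := EY t m 1; have he := EYR t m 1.
have E1 (f : R -> R) : \int[P]_w f (1 * dotv t (X w)) = \int[P]_w f (dotv t (X w)).
  by apply: eq_Rintegral => w _; rewrite mul1r.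
move: hc hs he; rewrite cosY sinY mgR !E1 !mul1r expr1n mulr1.
set C := \int[P]_w cos _; set S := \int[P]_w sin _; set M := \int[P]_w expR _.
set q := s ^+ 2 / 2 => hc hs he.
have ME : M = expR q * expR m.
  by rewrite he -mulrA [X in _ * X]mulrC expRxMexpNx_1 mulr1.
(* The centring formulas at s = 1 read C cos m + S sin m = exp(-q) and S cos m - C sin m = 0;
   inverting this rotation gives C and S. *)
have CE : C = expR (- q) * cos m.
  transitivity (C * (cos m ^+ 2 + sin m ^+ 2)); first by rewrite cos2Dsin2 mulr1.
  by transitivity ((C * cos m + S * sin m) * cos m - (S * cos m - C * sin m) * sin m);
    [ring|rewrite -hc -hs; ring].
have SE : S = expR (- q) * sin m.
  transitivity (S * (cos m ^+ 2 + sin m ^+ 2)); first by rewrite cos2Dsin2 mulr1.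
  by transitivity ((C * cos m + S * sin m) * sin m + (S * cos m - C * sin m) * cos m);
    [ring|rewrite -hc -hs; ring].
have qq := expRxMexpNx_1 q.
by rewrite CE SE ME; split; rewrite -[RHS]mul1r -[X in _ = X * _]qq; ring.
Qed.
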